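(* Let $N\ge 1$, $a,b,\gamma\ge 0$, $0<\alpha\le 1$, $0<s<1$, and for a nonnegative initial datum $\varphi$ consider the Cauchy problem $$\partial_t^\alpha v(x,t)=t^{\gamma}\,\mathscr{L}_{a,b}v(x,t)\ \text{ in }\mathbb{R}^N\times(0,\infty),\qquad v(x,0)=\varphi(x)\ \text{ in }\mathbb{R}^N, \qquad (\ast)$$ where $\mathscr{L}_{a,b}=a\Delta-b(-\Delta)^s$. Suppose that for every nonnegative $\varphi\in L^1(\mathbb{R}^N)\cap L^\infty(\mathbb{R}^N)$ the solution $v$ of $(\ast)$ is nonnegative and satisfies $v(x,\cdot)\in L^1(0,\infty)$. Let $\mathbf{S}$ be a subordinator with associated kernel $\mathbf{k}$, Laplace transform $\mathcal{K}$ of $\mathbf{k}$, and associated density $G_t$, and suppose in addition that $$\lim_{\lambda\to0^+}\lambda\,\mathcal{K}(\lambda)=0$$ and that, for some $\varrho\ge 0$, the function $L(x):=x^{-\varrho}\mathcal{K}(x^{-1})$ is slowly varying at infinity, i.e. $\lim_{x\to\infty}L(\lambda x)/L(x)=1$ for all $\lambda>0$. Then the Cesàro mean $\mathbf{M}_t(v^E(x,t))$ of the subordinated solution $v^E$ satisfies, as $t\to\infty$, $$\Gamma(\varrho+1)\,\mathbf{M}_t(v^{E}(x,t))\ \underset{t\to\infty}{\sim}\ \|v(x,\cdot)\|_{1}\,\Big(t^{-1}\mathcal{K}(t^{-1})\Big).$$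
   Context: Notation. $f(t)\underset{t\to\infty}{\sim}g(t)$ means $\lim_{t\to\infty}f(t)/g(t)=1$. $\Gamma$ is the Gamma function. $\|v(x,\cdot)\|_1=\int_0^\infty |v(x,\tau)|\,d\tau$ is the $L^1(0,\infty)$ norm in time. Operators. The fractional Laplacian is $(-\Delta)^s u=\mathcal{F}^{-1}(|\xi|^{2s}\mathcal{F}u)$ with $\mathcal{F}$ the Fourier transform in $x$. For $0<\alpha<1$, $\partial_t^\alpha$ is the Caputo derivative $\partial_t^\alpha u(t)=\frac{1}{\Gamma(1-\alpha)}\frac{d}{dt}\int_0^t (t-r)^{-\alpha}(u(r)-u(0))\,dr$; for $\alpha=1$ it is the ordinary derivative. Subordinators. A subordinator $\mathbf{S}=\{\mathbf{S}_t\}_{t\ge0}$ is a non-decreasing Lévy process with values in $[0,\infty)$, $\mathbf{S}_0=0$. Its Laplace transform is $\mathbb{E}[e^{-\lambda\mathbf{S}_t}]=e^{-t\Phi(\lambda)}$, $\lambda\ge0$, where $\Phi(\lambda)=\int_0^\infty(1-e^{-\lambda\tau})\,d\sigma(\tau)$ and the Lévy measure $\sigma$ satisfies $\int_0^\infty(1\wedge\tau)\,d\sigma(\tau)<\infty$. The associated kernel is $\mathbf{k}(t)=\sigma((t,\infty))$, assumed positive and in $L^1_{\mathrm{loc}}(0,\infty)$, and $\mathcal{K}(\lambda)=\int_0^\infty e^{-\lambda t}\mathbf{k}(t)\,dt=\Phi(\lambda)/\lambda$, so that $\Phi(\lambda)=\lambda\mathcal{K}(\lambda)$. The inverse subordinator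 is $E_t=\inf\{r\ge0:\mathbf{S}_r\ge t\}$, and $G_t(\tau)$ denotes its marginal density: $G_t(\tau)=\partial_\tau\mathbb{P}(E_t\le\tau)=-\partial_\tau\mathbb{P}(\mathbf{S}_\tau<t)$. Subordinated solution and Cesàro mean. $$v^{E}(x,t)=\int_0^\infty v(x,\tau)G_t(\tau)\,d\tau,\qquad \mathbf{M}_t(v^{E}(x,t))=\frac1t\int_0^t v^{E}(x,r)\,dr,\qquad (x,t)\in\mathbb{R}^N\times(0,\infty).$$ *)

(* Defs.v *)
From HB Require Import structures.
From mathcomp Require Import all_boot all_order all_algebra.
From mathcomp Require Import complex.
From mathcomp Require Import all_classical all_reals all_analysis.

Set Implicit Arguments.
Unset Strict Implicit.
Unset Printing Implicit Defensive.

Import Order.TTheory GRing.Theory Num.Theory.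
Import numFieldTopology.Exports numFieldNormedType.Exports.

Local Open Scope classical_set_scope.
Local Open Scope ring_scope.

Section measurable_rV.
Context {d} {T : measurableType d}.
Variable n : nat.

Definition rV_cylinders : set_system 'rV[T]_n :=
  [set A | exists (i : 'I_n) (B : set T),
    measurable B /\ A = [set x : 'rV[T]_n | B (x ord0 i)]].

Let rV_set0 : <<s rV_cylinders >> set0.
Proof. exact: sigma_algebra0. Qed.

Let rV_setC A : <<s rV_cylinders >> A -> <<s rV_cylinders >> (~` A).
Proof. exact: sigma_algebraC. Qed.

Let rV_bigcup (F : _^nat) : (forall i, <<s rV_cylinders >> (F i)) ->
  <<s rV_cylinders >> (\bigcup_i (F i)).
Proof. exact: sigma_algebra_bigcup. Qed.

HB.instance Definition _ := @isMeasurable.Build (measure_tuple_display d)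
  'rV[T]_n <<s rV_cylinders >> rV_set0 rV_setC rV_bigcup.

End measurable_rV.

Section lebesgue_rV.
Variable R : realType.

Lemma measurable_coord n (i : 'I_n) :
  measurable_fun [set: 'rV[R]_n] (fun x : 'rV[R]_n => x ord0 i).
Proof.
move=> _ B mB; rewrite setTI; apply: sub_sigma_algebra.
by exists i, B.
Qed.

Lemma measurable_fun_rV d (T : measurableType d) n (f : T -> 'rV[R]_n) :
  (forall i, measurable_fun [set: T] (fun t => f t ord0 i)) ->
  measurable_fun [set: T] f.
Proof.
move=> mf; apply: (@measurability _ _ _ _ _ _ (@rV_cylinders _ R n)) => //.
move=> _ [A [i [B [mB ->]]] <-].
exact: (mf i measurableT B mB).
Qed.

Definition cons_rV n (p : measurableTypeR R * 'rV[R]_n) : 'rV[R]_n.+1 :=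
  \row_i oapp (p.2 ord0) p.1 (unlift ord0 i).

Definition uncons_rV n (x : 'rV[R]_n.+1) : measurableTypeR R * 'rV[R]_n :=
  (x ord0 ord0, \row_i x ord0 (lift ord0 i)).

Lemma cons_rVK n : cancel (@cons_rV n) (@uncons_rV n).
Proof.
move=> [a x]; rewrite /uncons_rV mxE unlift_none/=; congr pair.
by apply/rowP => i; rewrite !mxE liftK.
Qed.

Lemma measurable_cons_rV n : measurable_fun [set: measurableTypeR R * 'rV[R]_n] (@cons_rV n).
Proof.
apply: measurable_fun_rV => i.
have [j ->|->] := unliftP ord0 i.
- under eq_fun do rewrite mxE liftK/=.
  exact: (measurableT_comp (@measurable_coord n j) measurable_snd).
- under eq_fun do rewrite mxE unlift_none/=.
  exact: measurable_fst.
Qed.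

Lemma measurable_uncons_rV n :
  measurable_fun [set: 'rV[R]_n.+1] (@uncons_rV n).
Proof.
apply: measurable_fun_pair; first exact: measurable_coord.
apply: measurable_fun_rV => i; under eq_fun do rewrite mxE.
exact: measurable_coord.
Qed.

Section step.
Variables (n : nat) (m : {sigma_finite_measure set 'rV[R]_n -> \bar R}).

Definition lebesgue_cons : set 'rV[R]_n.+1 -> \bar R :=
  pushforward (lebesgue_measure \x m)%E (@cons_rV n).

Let preimage_cons A : measurable A -> measurable (@cons_rV n @^-1` A).
Proof.
by move=> mA; rewrite -[X in measurable X]setTI; exact: measurable_cons_rV.
Qed.

Let lebesgue_cons0 : lebesgue_cons set0 = 0%E.
Proof.
by rewrite /lebesgue_cons /pushforward preimage_set0 measure0.
Qed.

Let lebesgue_cons_ge0 A : (0 <= lebesgue_cons A)%E.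
Proof. exact: (@measure_ge0 _ _ _ (lebesgue_measure \x m)%E). Qed.

Let lebesgue_cons_sigma_additive : semi_sigma_additive lebesgue_cons.
Proof.
move=> F mF tF mUF; rewrite /lebesgue_cons /pushforward preimage_bigcup.
apply: measure_semi_sigma_additive.
- by move=> i; exact: preimage_cons.
- apply/trivIsetP => /= i j _ _ ij; rewrite -preimage_setI.
  by move/trivIsetP : tF => /(_ _ _ _ _ ij) ->//; rewrite preimage_set0.
- by rewrite -preimage_bigcup; exact: preimage_cons.
Qed.

HB.instance Definition _ := isMeasure.Build _ _ _ lebesgue_cons
  lebesgue_cons0 lebesgue_cons_ge0 lebesgue_cons_sigma_additive.

Let lebesgue_cons_sigma_finite : sigma_finite setT lebesgue_cons.
Proof.
have /sigma_finiteP[F [TF ndF Foo]] := sigma_finiteT (@lebesgue_measure R).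
have /sigma_finiteP[G [TG ndG Goo]] := sigma_finiteT m.
exists (fun k => @uncons_rV n @^-1` (F k `*` G k)).
  rewrite -preimage_bigcup; apply/esym/seteqP; split => // x _.
  have [i _ Fi] : (\bigcup_i F i) (uncons_rV x).1 by rewrite -TF.
  have [j _ Gj] : (\bigcup_i G i) (uncons_rV x).2 by rewrite -TG.
  exists (maxn i j) => //; split.
    by move: Fi; apply/subsetPset/ndF/leq_maxl.
  by move: Gj; apply/subsetPset/ndG/leq_maxr.
move=> k; have [mFk Fkoo] := Foo k; have [mGk Gkoo] := Goo k; split.
  by rewrite -[X in measurable X]setTI;
    apply: measurable_uncons_rV => //; exact: measurableX.
rewrite /lebesgue_cons /pushforward -comp_preimage.
rewrite (_ : _ \o _ = id) ?preimage_id; last first.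
  by apply/funext => p /=; rewrite cons_rVK.
by rewrite product_measure1E// lte_mul_pinfty// ge0_fin_numE.
Qed.

HB.instance Definition _ := Measure_isSigmaFinite.Build _ _ _ lebesgue_cons
  lebesgue_cons_sigma_finite.

End step.

(* Lebesgue measure on R^n: the n-fold product of Lebesgue measure on R. *)
Fixpoint lebesgue_rV n : {sigma_finite_measure set 'rV[R]_n -> \bar R} :=
  match n with
  | 0 => dirac (0 : 'rV[R]_0)
  | n.+1 => lebesgue_cons (lebesgue_rV n)
  end.

End lebesgue_rV.

Section operators.
Variable R : realType.
Local Notation mu := (@lebesgue_measure R).

Definition Gamma (z : R) : R :=
  \int[mu]_(t in `]0, +oo[) (t `^ (z - 1) * expR (- t)).

Section space.
Variable N : nat.
Local Notation V := 'rV[R]_N.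
Local Notation leb := (lebesgue_rV R N).

Definition dotp (x y : V) : R := \sum_(i < N) x ord0 i * y ord0 i.

(* The norm `|x| of the library on 'rV[R]_N is the sup norm. *)
Definition enorm (x : V) : R := Num.sqrt (dotp x x).

Definition cintegral (f : V -> R[i]) : R[i] :=
  ((\int[leb]_x complex.Re (f x)) +i* (\int[leb]_x complex.Im (f x)))%C.

Definition cis (t : R) : R[i] := (cos t +i* sin t)%C.

Definition fourier (u : V -> R[i]) (xi : V) : R[i] :=
  cintegral (fun x => u x * cis (- dotp x xi)).

Definition fourier_inv (w : V -> R[i]) (x : V) : R[i] :=
  (((2 * pi) ^+ N)^-1)%:C%C * cintegral (fun xi => w xi * cis (dotp x xi)).

Definition frac_laplacian (s : R) (u : V -> R[i]) : V -> R[i] :=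
  fourier_inv (fun xi => (enorm xi `^ (2 * s))%:C%C * fourier u xi).

Definition partial (i : 'I_N) (u : V -> R) (x : V) : R :=
  'D_(delta_mx ord0 i) u x.

Definition laplacian (u : V -> R) (x : V) : R :=
  \sum_(i < N) partial i (partial i u) x.

(* frac_laplacian s of a real-valued function is real-valued, so that taking
   the real part loses nothing. *)
Definition Lab (a b s : R) (u : V -> R) (x : V) : R :=
  a * laplacian u x
  - b * complex.Re (frac_laplacian s (fun y => (u y)%:C%C) x).

Definition smooth (u : V -> R) : Prop :=
  forall l : seq 'I_N, let g := foldr partial u l in
    continuous g /\ forall (i : 'I_N) x, derivable g x (delta_mx ord0 i).

Definition test_function (u : V -> R) : Prop :=
  smooth u /\ compact (closure [set x | u x != 0]).

End space.

Definition has_caputo (alpha : R) (u : R -> R) (t d : R) : Prop :=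
  if alpha == 1 then is_derive t 1 u d
  else is_derive t 1 (fun t' => (Gamma (1 - alpha))^-1 *
         \int[mu]_(r in `]0, t'[) ((t' - r) `^ (- alpha) * (u r - u 0))) d.

(* The equation is understood in the sense of distributions in x: as L_{a,b} is
   symmetric, it is tested against u in C_c^oo with L_{a,b} acting on u.  For
   initial data in L^1 and L^oo only, the solution is in general not regular
   enough for L_{a,b} v to be a function defined pointwise. *)
Record is_solution (N : nat) (a b gamma alpha s : R)
    (phi : 'rV[R]_N -> R) (v : 'rV[R]_N -> R -> R) : Prop := {
  solution_L1 : forall t, 0 <= t -> v^~ t \in Lfun (lebesgue_rV R N) 1;
  solution_init : forall x, v x 0 = phi x;
  solution_continuous : forall u, test_function u ->
    {within `[0, +oo[, continuous
      (fun t => \int[lebesgue_rV R N]_x (v x t * u x))};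
  solution_equation : forall u, test_function u -> forall t, 0 < t ->
    has_caputo alpha (fun r => \int[lebesgue_rV R N]_x (v x r * u x)) t
      (t `^ gamma * \int[lebesgue_rV R N]_x (v x t * Lab a b s u x)) }.

End operators.

Section subordinators.
Variable R : realType.
Local Notation mu := (@lebesgue_measure R).

(* A process is indexed by the times t >= 0; its values at negative indices are
   ignored. *)
Record levy_process d (T : measurableType d) (P : probability T R)
    (S : R -> {RV P >-> R}) : Prop := {
  levy0 : forall w, S 0 w = 0;
  levy_independent : forall (t : nat -> R) (B : nat -> set R) (n : nat),
    0 <= t 0%N -> (forall i, t i <= t i.+1) -> (forall i, measurable (B i)) ->
    let A i := [set w | B i (S (t i.+1) w - S (t i) w)] in
    P (\bigcap_(i < n) A i) = (\prod_(i < n) P (A i))%E;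
  levy_stationary : forall (r h : R) (B : set R),
    0 <= r -> 0 <= h -> measurable B ->
    P [set w | B (S (r + h) w - S r w)] = P [set w | B (S h w)];
  levy_right_continuous : forall w t, 0 <= t ->
    S r w @[r --> t^'+] --> S t w;
  levy_left_limit : forall w t, 0 < t -> cvg (S r w @[r --> t^'-]) }.

Definition subordinator d (T : measurableType d) (P : probability T R)
    (S : R -> {RV P >-> R}) : Prop :=
  [/\ levy_process S,
      forall w t, 0 <= t -> 0 <= S t w &
      forall w r t, 0 <= r -> r <= t -> S r w <= S t w].

Section levy_measure.
(* Only the restriction of sigma to (0, +oo) is used. *)
Variable sigma : {measure set R -> \bar R}.

Definition laplace_exponent (lambda : R) : R :=
  \int[sigma]_(tau in `]0, +oo[) (1 - expR (- (lambda * tau))).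

Definition levy_kernel (t : R) : R := fine (sigma `]t, +oo[%classic).

Definition kernel_laplace (lambda : R) : R :=
  \int[mu]_(t in `]0, +oo[) (expR (- (lambda * t)) * levy_kernel t).

Definition levy_measure_of d (T : measurableType d) (P : probability T R)
    (S : R -> {RV P >-> R}) : Prop :=
  (\int[sigma]_(tau in `]0%R, +oo[) (Num.min 1 tau)%R%:E < +oo)%E /\
  forall lambda t, 0 <= lambda -> 0 <= t ->
    'E_P[fun w => expR (- (lambda * S t w))]%E =
    (expR (- (t * laplace_exponent lambda)))%:E.

End levy_measure.

Definition inverse_subordinator d (T : measurableType d) (P : probability T R)
    (S : R -> {RV P >-> R}) (t : R) (w : T) : \bar R :=
  ereal_inf [set r%:E | r in [set r : R | 0 <= r /\ t <= S r w]].

(* G t is a density of E_t for every t > 0; by Lebesgue differentiation,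
   G t tau is the derivative in tau of P (E_t <= tau) for almost every tau. *)
Definition marginal_density d (T : measurableType d) (P : probability T R)
    (S : R -> {RV P >-> R}) (G : R -> R -> R) : Prop :=
  forall t : R, 0 < t ->
    [/\ measurable_fun (`]0, +oo[ : set R) (G t),
        forall tau, 0 < tau -> 0 <= G t tau &
        forall tau, 0 <= tau ->
          P [set w | (inverse_subordinator S t w <= tau%:E)%E] =
          (\int[mu]_(u in `]0%R, tau]) (G t u)%:E)%E].

End subordinators.

Section asymptotics.
Variable R : realType.
Local Notation mu := (@lebesgue_measure R).

Definition L1norm (f : R -> R) : R := \int[mu]_(tau in `]0, +oo[) `|f tau|.

(* Valued in [0, +oo]: for exceptional t the integral may be infinite. *)
Definition subordinated (f : R -> R) (G : R -> R -> R) (t : R) : \bar R :=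
  (\int[mu]_(tau in `]0%R, +oo[) (f tau * G t tau)%:E)%E.

Definition cesaro_mean (f : R -> \bar R) (t : R) : R :=
  t^-1 * fine (\int[mu]_(r in `]0%R, t[) f r)%E.

Definition slowly_varying (L : R -> R) : Prop :=
  forall c, 0 < c -> L (c * x) / L x @[x --> +oo] --> (1 : R).

Definition asymp_equiv (f g : R -> R) : Prop :=
  f t / g t @[t --> +oo] --> (1 : R).

End asymptotics.

(* Main.v *)
Require Import Defs.
From mathcomp Require Import all_boot all_order all_algebra.
From mathcomp Require Import all_classical all_reals all_analysis.
From mathcomp Require Import measurable_realfun ring lra.
From HB Require Import structures.
Set Implicit Arguments.
Unset Strict Implicit.
Unset Printing Implicit Defensive.
Import Order.TTheory GRing.Theory Num.Theory.
Import numFieldTopology.Exports numFieldNormedType.Exports.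
Local Open Scope classical_set_scope.
Local Open Scope ring_scope.

(** Write [f = v x], a nonnegative integrable function on the half-line, and let
    [Phi] be the Laplace exponent of the subordinator and [K] the Laplace
    transform of its kernel, so that [Phi l = l * K l]. The inverse subordinator
    at time [t] is at most [tau] exactly when the subordinator at time [tau] is at
    least [t]. Hence, at an independent exponential time of rate [l], the inverse
    subordinator is exponential of rate [Phi l]
    ([finite_inverse_exponential_time]), and integrating [f] against these laws
    gives the Laplace transform of the subordinated function
    ([integral_subordinated]):

      int_0^oo e^(-lt) vE(t) dt = K(l) * int_0^oo e^(-Phi(l) x) f(x) dx.

    As [l] tends to 0, [Phi l] tends to 0 by hypothesis, so by dominated
    convergence the right-hand side is equivalent to [K l] times the norm of [f],
    when that norm is not 0.
    By hypothesis [K] varies regularly at 0 with index [- rho], and Karamata's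
    Tauberian theorem ([karamata_tauberian]) converts this into the equivalence of
    the primitive of [vE] at [t] with the norm of [f] times
    [K t^-1 / Gamma (rho + 1)]. Dividing by [t] gives the Cesaro mean.
    If the norm is 0, the transform of [vE] vanishes and so does its primitive.

    Karamata's theorem is applied to the primitive [U] of [vE], which is monotone.
    Rescaled by its transform, [U] has convergent exponential moments. Polynomials
    in [e^(-t)] approximate Lipschitz bumps uniformly ([bernstein_approx]), so the
    integrals against such bumps converge, and monotonicity turns this into
    convergence at a point ([moments_cvg]). *)

(** * Measures with a density, and measures determined by a distribution function *)

Section density.
Local Open Scope ereal_scope.
Context {d} {T : measurableType d} {R : realType}.
Variable mu : {measure set T -> \bar R}.

Section density_measure.
Variable g : T -> R.

(** Carrying the two proofs as arguments makes the measure structure of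
    [density_measure mg g0] inferable from the term alone. *)
Definition density_measure (_ : measurable_fun [set: T] g)
  (_ : forall x, (0 <= g x)%R) : set T -> \bar R :=
  fun A => \int[mu]_(x in A) (g x)%:E.

Hypotheses (mg : measurable_fun [set: T] g) (g0 : forall x, (0 <= g x)%R).
Local Notation m := (density_measure mg g0).

Let m0 : m set0 = 0. Proof. exact: integral_set0. Qed.

Let m_ge0 A : 0 <= m A.
Proof. by apply: integral_ge0 => x _; rewrite lee_fin. Qed.

Let m_sigma_additive : semi_sigma_additive m.
Proof.
move=> F mF tF mUF; apply: cvg_toP.
  apply: ereal_nondecreasing_is_cvgn => i j ij.
  by apply: lee_sum_nneg_natr => // k _ _; exact: m_ge0.
rewrite /density_measure ge0_integral_bigcup//.
- exact/measurable_EFinP/measurable_funTS.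
- by move=> x _; rewrite lee_fin.
Qed.

HB.instance Definition _ := isMeasure.Build _ _ _ m m0 m_ge0 m_sigma_additive.

End density_measure.

Import HBNNSimple.

Variables (m : {measure set T -> \bar R}) (g : T -> R).
Hypotheses (mg : measurable_fun [set: T] g) (g0 : forall x, (0 <= g x)%R).
Hypothesis mE : forall A, measurable A -> m A = \int[mu]_(x in A) (g x)%:E.

Let ge0_integral_density_nnsfun (f : {nnsfun T >-> R}) :
  \int[m]_x (f x)%:E = \int[mu]_x ((g x)%:E * (f x)%:E).
Proof.
under [LHS]eq_integral do rewrite fimfunE -fsumEFin//.
rewrite [LHS]ge0_integral_fsum//; last 2 first.
  - by move=> r; exact/measurable_EFinP/measurableT_comp.
  - by move=> n x _; rewrite EFinM nnfun_muleindic_ge0.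
under [RHS]eq_integral.
  move=> x xD; rewrite fimfunE -fsumEFin// ge0_mule_fsumr; last first.
    by move=> r; rewrite EFinM nnfun_muleindic_ge0.
  over.
rewrite [RHS]ge0_integral_fsum//; last 2 first.
  - move=> r; apply: emeasurable_funM; first exact/measurable_EFinP.
    by apply/measurable_EFinP; do 2 apply/measurableT_comp => //.
  - move=> n x _; apply: mule_ge0; first by rewrite lee_fin.
    by rewrite EFinM nnfun_muleindic_ge0.
apply: eq_fsbigr => r /[!inE] -[x _ <-].
have fx0 : 0 <= (f x)%:E by rewrite lee_fin.
transitivity ((f x)%:E * \int[m]_y (\1_(f @^-1` [set f x]) y)%:E).
  rewrite -ge0_integralZl//; exact/measurable_EFinP.
rewrite integral_indic// setIT mE//.
rewrite integral_mkcond -ge0_integralZl//; last 2 first.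
- apply/(measurable_restrictT _ _).1 => //.
  by apply: measurable_funTS; exact/measurable_EFinP.
- by move=> y _; rewrite patchE; case: ifPn => // _; rewrite lee_fin.
apply: eq_integral => y _; rewrite patchE indicE.
by case: ifPn => _; rewrite ?(mulr1, mule0, mulr0)// muleC.
Qed.

(** The change of density formula: by definition it holds for indicators, hence
    for nonnegative simple functions by linearity, and both sides pass to
    increasing limits. *)
Lemma ge0_integral_density (f : T -> \bar R) :
  measurable_fun [set: T] f -> (forall x, 0 <= f x) ->
  \int[m]_x f x = \int[mu]_x ((g x)%:E * f x).
Proof.
move=> mf f0; pose f_ := nnsfun_approx measurableT mf.
transitivity (lim (\int[m]_x (f_ n x)%:E @[n --> \oo])).
  rewrite -monotone_convergence//=.
  - apply: eq_integral => x _; apply/esym/cvg_lim => //=.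
    exact: cvg_nnsfun_approx.
  - by move=> n; exact/measurable_EFinP/measurable_funTS.
  - by move=> n ? _; rewrite lee_fin.
  - by move=> ? _ ? ? mn; rewrite lee_fin; exact/lefP/nd_nnsfun_approx.
under eq_fun do rewrite ge0_integral_density_nnsfun.
rewrite -monotone_convergence//=.
- apply: eq_integral => x _; apply/cvg_lim => //=.
  by apply: cvgeZl => //; exact: cvg_nnsfun_approx.
- by move=> n; apply: emeasurable_funM; exact/measurable_EFinP.
- by move=> n ? _; rewrite mule_ge0 ?lee_fin.
- move=> x _ ? ? mn; rewrite lee_wpmul2l ?lee_fin//.
  exact/lefP/nd_nnsfun_approx.
Qed.

End density.

Section determined_by_cdf.
Local Open Scope ereal_scope.
Context {R : realType}.
Local Notation mu := (@lebesgue_measure R).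

(** The form in which the uniqueness of measures is used below. The half-open
    intervals form a pi-system generating the Borel sets, and their traces on the
    half-line are differences of intervals [`]0, x]]; so the values on those
    intervals determine the restriction of [m] to the half-line. *)
Lemma ge0_integral_of_cdf (m : {measure set (measurableTypeR R) -> \bar R})
    (g : R -> R) (f : R -> \bar R) :
  measurable_fun (`]0%R, +oo[%classic : set R) g ->
  (forall x, (0 < x)%R -> (0 <= g x)%R) ->
  (forall x, (0 < x)%R -> m `]0%R, x]%classic < +oo) ->
  (forall x, (0 < x)%R -> m `]0%R, x]%classic = \int[mu]_(u in `]0%R, x]) (g u)%:E) ->
  measurable_fun (`]0%R, +oo[%classic : set R) f ->
  (forall x, (0 < x)%R -> 0 <= f x) ->
  \int[m]_(x in `]0%R, +oo[) f x =
  \int[mu]_(x in `]0%R, +oo[) ((g x)%:E * f x).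
Proof.
move=> mg g0 mfin mE mf f0.
pose D : set R := `]0%R, +oo[%classic.
have mD : measurable D by exact: measurable_itv.
have DE x : D x = (0 < x)%R :> Prop by rewrite /D/= in_itv/= andbT.
pose g' := g \_ D.
have mg' : measurable_fun [set: R] g' by exact/(measurable_restrictT _ _).1.
have g'0 x : (0 <= g' x)%R.
  rewrite /g' patchE; case: ifPn => //.
  by rewrite inE DE => /g0.
pose m1 := mrestr m mD.
pose m2 := density_measure mu mg' g'0.
have D0 (x : R) : (0 < x)%R -> `]0%R, x]%classic `<=` D.
  by move=> x0 y; rewrite DE/= in_itv/= => /andP[].
have e0 (x : R) : (0 < x)%R -> m1 `]0%R, x]%classic = m2 `]0%R, x]%classic.
  move=> x0; rewrite /m1/= /mrestr setIidl; last exact: D0.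
  rewrite mE// /m2 /density_measure; apply: eq_integral => y.
  by rewrite inE => /(D0 _ x0) Dy; rewrite /g' patchE mem_set.
have m1fin (x : R) : (0 < x)%R -> m1 `]0%R, x]%classic < +oo.
  by move=> x0; rewrite /m1/= /mrestr setIidl ?mfin//; exact: D0.
have Nneg (a b : R) : (b <= 0)%R -> `]a, b]%classic `&` D = set0.
  move=> b0; apply/seteqP; split => // y []; rewrite DE/= in_itv/=.
  move=> /andP[_ yb] y0; have := le_lt_trans (le_trans yb b0) y0.
  by rewrite ltxx.
have m2D A : measurable A -> m2 A = m2 (A `&` D).
  move=> mA; rewrite /m2 /density_measure.
  rewrite [in LHS]integral_mkcond [in RHS]integral_mkcond.
  apply: eq_integral => y _; rewrite !patchE in_setI /g' patchE.
  by case: (y \in A); case: (y \in D).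
have m1E A : m1 A = m (A `&` D) by [].
have e1 A : measurable A -> m1 A = m2 A.
  apply: (@measure_unique _ _ (measurableTypeR R) (@ocitv R)
    (fun n => `](- n%:R)%R, n%:R%R]%classic)) => //.
  - exact: ocitvI.
  - by move=> n; exact: is_ocitv.
  - apply/seteqP; split => // x _.
    exists (Num.bound x) => //=.
    by rewrite in_itv/= ltrNl unstable.ltrNbound ltW// unstable.ltr_bound.
  - move=> _ [[a b] _ <-]; rewrite -[LHS]/(m1 _) -[RHS]/(m2 _)/=.
    have [b0|b0] := leP b 0%R.
      rewrite m1E Nneg// measure0 m2D; last exact: measurable_itv.
      by rewrite Nneg// measure0.
    have [a0|a0] := leP a 0%R.
      have abD : `]a, b]%classic `&` D = `]0%R, b]%classic.
        apply/seteqP; split => y; rewrite /= DE !in_itv/=.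
          by move=> [/andP[_ ->] ->].
        by move=> /andP[y0 ->]; rewrite y0 (le_lt_trans a0 y0).
      rewrite m2D; last exact: measurable_itv.
      rewrite abD -e0// !m1E abD setIidl//; exact: D0.
    have [ba|ab] := leP b a.
      have -> : `]a, b]%classic = set0 by rewrite set_itv_ge// bnd_simp -leNgt.
      by transitivity (0 : \bar R); [exact: measure0|exact/esym/measure0].
    have -> : `]a, b]%classic = `]0%R, b]%classic `\` `]0%R, a]%classic.
      apply/seteqP; split => y; rewrite /= !in_itv/=.
        move=> /andP[ay ->]; rewrite (lt_trans a0 ay); split => //.
        by move=> /= ya; have := lt_le_trans ay ya; rewrite ltxx.
      by move=> [/andP[-> ->]] /negP; rewrite andbT/= -ltNge => ->.
    have mdiff (m' : {measure set (measurableTypeR R) -> \bar R}) :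
        m' `]0%R, b]%classic < +oo ->
        m' (`]0%R, b]%classic `\` `]0%R, a]%classic) =
        m' `]0%R, b]%classic - m' `]0%R, a]%classic.
      move=> bfin; rewrite measureD//; try exact: measurable_itv.
      by rewrite setIidr//; apply: subset_itvl; rewrite bnd_simp ltW.
    transitivity (m1 `]0%R, b]%classic - m1 `]0%R, a]%classic).
      by apply: mdiff; exact: m1fin.
    by rewrite !e0//; apply/esym/mdiff; rewrite -[X in X < _]/(m2 _) -e0// m1fin.
  - move=> n.
    have [n0|n0] := leP n%:R (0%R : R).
      by rewrite -[X in X < _]/(m1 _) m1E Nneg// measure0.
    rewrite -[X in X < _]/(m1 _).
    have -> : m1 `](- n%:R)%R, n%:R%R]%classic = m1 `]0%R, n%:R%R]%classic.
      rewrite !m1E; congr (m _).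
      apply/seteqP; split => y; rewrite /= DE !in_itv/= => -[].
        by move=> /andP[_ ->] ->.
      by move=> /andP[_ ->] y0; rewrite y0 (lt_trans _ y0)// oppr_lt0.
    exact: m1fin.
transitivity (\int[m2]_(x in D) f x).
  apply: eq_measure_integral => A mA AD.
  by rewrite -[RHS]/(m2 A) -e1// m1E setIidl.
rewrite [LHS]integral_mkcond (@ge0_integral_density _ _ _ mu _ g')//.
- rewrite [RHS]integral_mkcond; apply: eq_integral => y _.
  by rewrite /g' !patchE; case: ifPn => //; rewrite mul0e.
- exact/(measurable_restrictT _ _).1.
- by move=> y; rewrite patchE; case: ifPn => //; rewrite inE DE => /f0.
Qed.

End determined_by_cdf.

(** * The exponential law *)

Section exponential_law.
Context {R : realType}.
Local Notation mu := (@lebesgue_measure R).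

(** The exponential law of rate [l] as a probability; the proof argument keeps
    the structure inferable. Laplace transforms are written below as integrals
    against this law, that is, as [l] times the usual transform. *)
Definition exponential_law (l : R) (l0 : 0 < l) : probability (measurableTypeR R) R.
Proof. refine (exponential_prob l); exact: l0. Defined.

Variables (l : R) (l0 : 0 < l).

Lemma exponential_law_itv (b : bool) (x : R) : 0 <= x ->
  exponential_law l0 [set` Interval (BRight 0) (BSide b x)] =
  (1 - expR (- (l * x)))%:E.
Proof.
rewrite le_eqVlt => /predU1P[<-|x0].
  rewrite mulr0 oppr0 expR0 subrr set_itv_ge ?measure0//.
  by case: b; rewrite bnd_simp ltxx.
rewrite -[LHS]/(exponential_prob l _) /exponential_prob.
have mpdf A : measurable_fun A (EFin \o exponential_pdf l).
  apply/measurable_EFinP/measurable_funTS.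
  by apply: measurable_exponential_pdf; exact: ltW.
rewrite integral_itv_bndoo; last exact: mpdf.
rewrite -(@integral_itv_bndoo _ _ _ _ true false); last exact: mpdf.
rewrite -[LHS]/(exponential_prob l `[0, x]%classic).
by rewrite exponential_prob_itv0c// mulNr.
Qed.

Lemma measurable_exponential_density (A : set R) :
  measurable_fun A (fun x => l * expR (- (l * x))).
Proof.
apply: measurable_funTS; apply: measurable_funM => //.
by apply: measurableT_comp => //; exact: measurableT_comp.
Qed.

Lemma exponential_law_density (x : R) : 0 < x ->
  exponential_law l0 `]0, x]%classic =
  (\int[mu]_(u in `]0%R, x]) (l * expR (- (l * u)))%:E)%E.
Proof.
move=> x0; rewrite -[LHS]/(exponential_prob l _) /exponential_prob.
apply: eq_integral => y; rewrite inE/= in_itv/= => /andP[/ltW y0 _].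
by rewrite exponential_pdfE// mulNr.
Qed.

Lemma integral_exponential_law (f : R -> \bar R) :
  measurable_fun (`]0, +oo[%classic : set R) f ->
  (forall x, 0 < x -> (0 <= f x)%E) ->
  (\int[exponential_law l0]_(t in `]0%R, +oo[) f t =
   \int[mu]_(t in `]0%R, +oo[) ((l * expR (- (l * t)))%:E * f t))%E.
Proof.
move=> mf f0; apply: ge0_integral_of_cdf => //.
- exact: measurable_exponential_density.
- by move=> x _; rewrite mulr_ge0 ?expR_ge0// ltW.
- by move=> x x0; rewrite (le_lt_trans (probability_le1 _ _)) ?ltry.
- exact: exponential_law_density.
Qed.

End exponential_law.

(** * The inverse subordinator *)

Section inverse_subordinator.
Context {R : realType} {d : measure_display} {T : measurableType d}.
Variables (P : probability T R) (S : R -> {RV P >-> R}).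
Hypothesis subS : subordinator S.
Local Notation mu := (@lebesgue_measure R).

Let levyS := let: And3 h _ _ := subS in h.
Let S_ge0 := let: And3 _ h _ := subS in h.
Let S_nd := let: And3 _ _ h := subS in h.

Lemma inverse_subordinator_ge0 t w : (0 <= inverse_subordinator S t w)%E.
Proof. by apply: le_ereal_inf_tmp => _ [r [r0 _] <-]; rewrite lee_fin. Qed.

(** Right-continuity is what makes this exact: if the path is still below [t] at
    time [tau], it stays below [t] on some interval to the right of [tau], and by
    monotonicity the first passage time is then larger than [tau]. *)
Lemma inverse_subordinator_le (t : R) w (tau : R) : 0 <= tau ->
  (inverse_subordinator S t w <= tau%:E)%E = (t <= S tau w).
Proof.
move=> tau0; apply/idP/idP; last first.
  by move=> tS; apply: ereal_inf_lbound; exists tau.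
apply: contraTT; rewrite -!ltNge => St.
have rS : \forall r \near tau^'+, (S r w < t) && (tau < r).
  near=> r; apply/andP; split; near: r; last exact: nbhs_right_gt.
  apply: cvgr_lt St; exact: levy_right_continuous levyS _ _ tau0.
have [r /andP[Sr taur]] := @filter_ex _ _ (at_right_proper_filter tau) _ rS.
rewrite (@lt_le_trans _ _ r%:E) ?lte_fin//.
apply: le_ereal_inf_tmp => _ [q [q0 tq] <-]; rewrite lee_fin leNgt.
apply/negP => qr; have := S_nd w q0 (ltW qr).
by move=> /(le_trans tq); rewrite leNgt Sr.
Unshelve. all: by end_near. Qed.

Lemma inverse_subordinator_gt0 (t : R) w : 0 < t ->
  (0 < inverse_subordinator S t w)%E.
Proof.
by move=> t0; rewrite ltNge inverse_subordinator_le// (levy0 levyS) -ltNge.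
Qed.

Lemma inverse_subordinator_eq0 (t : R) w : t <= 0 -> inverse_subordinator S t w = 0%E.
Proof.
move=> t0; apply/eqP; rewrite eq_le inverse_subordinator_ge0 andbT.
by rewrite inverse_subordinator_le// (levy0 levyS).
Qed.

(** The first passage time as a real function of level and path. An infinite
    passage time becomes 0, which lies outside the half-line on which the law of
    the passage time is studied, so that no mass is created there. *)
Definition finite_inverse (z : measurableTypeR R * T) : measurableTypeR R :=
  fine (inverse_subordinator S z.1 z.2).

(** Joint measurability in level and path: a sublevel set of the passage time is
    the set of pairs with [z.1 <= S x z.2], which is measurable for fixed [x]. *)
Lemma measurable_finite_inverse : measurable_fun setT finite_inverse.
Proof.
pose E (z : measurableTypeR R * T) := inverse_subordinator S z.1 z.2.
suff mE : measurable_fun setT E.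
  exact: (measurableT_comp (@fine_measurable R setT measurableT) mE).
apply: (measurability _ (ErealGenOInfty.measurableE R)).
move=> /= _ [_ [x ->] <-]; rewrite setTI.
rewrite preimage_itvoy.
have [x0|x0] := ltP x 0.
  rewrite (_ : [set _ | _] = setT)//; apply/seteqP; split => // z _ /=.
  by rewrite (@lt_le_trans _ _ 0%E) ?lte_fin// inverse_subordinator_ge0.
rewrite (_ : [set _ | _] = [set z | S x z.2 < z.1]); last first.
  by apply/seteqP; split => z /=; rewrite !ltNge inverse_subordinator_le.
rewrite -[X in measurable X]setTI.
apply: (measurable_fun_ltr _ _ measurableT (Y := [set true])) => //.
exact: measurableT_comp (measurable_funPT (S x)) measurable_snd.
Qed.

Lemma finite_inverse_itv (x : R) : 0 < x ->
  finite_inverse @^-1` `]0, x] = [set z | 0 < z.1 /\ z.1 <= S x z.2].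
Proof.
move=> x0; apply/seteqP; split => -[t w]/=; rewrite in_itv/= /finite_inverse/=.
- have [t0|t0] := leP t 0; first by rewrite inverse_subordinator_eq0//= ltxx.
  rewrite -(inverse_subordinator_le _ _ (ltW x0)).
  have := inverse_subordinator_ge0 t w.
  case: inverse_subordinator => [r| |]//=; last by rewrite ltxx.
  by rewrite lee_fin => _ /andP[].
- move=> [t0]; rewrite -(inverse_subordinator_le _ _ (ltW x0)).
  have := inverse_subordinator_gt0 w t0.
  case: inverse_subordinator => [r| |]//=.
  by rewrite lte_fin lee_fin => -> ->.
Qed.

End inverse_subordinator.

Section laplace_in_time.
Local Open Scope ereal_scope.
Context {R : realType} {d : measure_display} {T : measurableType d}.
Variables (P : probability T R) (S : R -> {RV P >-> R}) (G : R -> R -> R).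
Hypotheses (subS : subordinator S) (dG : marginal_density S G).
Local Notation mu := (@lebesgue_measure R).
Local Notation E := (finite_inverse S).

Let E_mfun : {mfun (measurableTypeR R * T)%type >-> measurableTypeR R} :=
  HB.pack E (isMeasurableFun.Build _ _ _ _ _ (measurable_finite_inverse subS)).

(** The inverse subordinator taken at an independent exponential time of rate [l]
    is exponential of rate [Phi]: it is at most [x] exactly when the exponential
    time is at most [S x], which given [S x] has probability
    [1 - expR (- (l * S x))], of mean [1 - expR (- (x * Phi))]. *)
Lemma finite_inverse_exponential_time (l : R) (l0 : (0 < l)%R) (Phi x : R) :
  (0 < x)%R -> 'E_P[fun w => expR (- (l * S x w))%R] = (expR (- (x * Phi)))%:E ->
  (exponential_law l0 \x P) (E @^-1` `]0%R, x]) =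
  (1 - expR (- (Phi * x)))%:E.
Proof.
move=> x0 Ex.
have mA : measurable (E @^-1` `]0%R, x]).
  by rewrite -[X in measurable X]setTI; apply: measurable_finite_inverse.
transitivity (\int[P]_w (exponential_law l0 (ysection (E @^-1` `]0%R, x]) w))).
  have := indic_fubini_tonelli (exponential_law l0) P mA.
  by rewrite (indic_fubini_tonelli_FE P mA) (indic_fubini_tonelli_GE _ mA).
transitivity (\int[P]_w (1 - (expR (- (l * S x w)))%:E)).
  apply: eq_integral => w _.
  have Sx0 : (0 <= S x w)%R by case: subS => _ S0 _; exact/S0/ltW.
  rewrite -EFinB -(exponential_law_itv l0 false Sx0).
  congr (exponential_law l0 _).
  rewrite (finite_inverse_itv subS x0); apply/seteqP; split => t /=.
    by rewrite /ysection/= inE/= in_itv/= => -[-> ->].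
  by rewrite in_itv/= /ysection/= inE/= => /andP[].
have mS : measurable_fun setT (fun w => (expR (- (l * S x w)))%R).
  apply: measurableT_comp => //; apply: measurableT_comp => //.
  by apply: measurable_funM => //; exact: measurable_funPT (S x).
rewrite integralB//=.
- rewrite integral_cst// [X in 1 * X](_ : _ = 1); last exact: probability_setT.
  rewrite mule1.
  by move: Ex; rewrite unlock (mulrC Phi) => ->.
- exact: finite_measure_integrable_cst.
- apply: (le_integrable measurableT _ _ (finite_measure_integrable_cst P (A := setT) 1%R measurableT)) => //.
    exact/measurable_EFinP.
  move=> w _ /=; rewrite lee_fin normr1 ger0_norm ?expR_ge0//.
  have Sx0 : (0 <= S x w)%R by case: subS => _ S0 _; exact/S0/ltW.
  by rewrite -[leRHS]expR0 ler_expR oppr_le0 mulr_ge0// ltW.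
Qed.

Section test_function.
Variable f : R -> R.
Hypotheses (mf : measurable_fun (`]0%R, +oo[%classic : set R) f)
           (f0 : forall x, (0 < x)%R -> (0 <= f x)%R).

Let F := (EFin \o f) \_ (`]0%R, +oo[%classic : set R).

Let mF : measurable_fun setT F.
Proof. by apply/(measurable_restrictT _ _).1 => //; exact/measurable_EFinP. Qed.

Let F0 x : 0 <= F x.
Proof.
rewrite /F patchE; case: ifPn => //.
by rewrite inE/= in_itv/= andbT lee_fin => /f0.
Qed.

Let mFE : measurable_fun setT (F \o E).
Proof. exact: (measurableT_comp mF (measurable_finite_inverse subS)). Qed.

(** The density [G t] is given for each [t] separately, without any joint
    measurability. Replacing the integral against it by an expectation over paths
    gives access to Tonelli's theorem. *)
Lemma subordinatedE (t : R) : (0 < t)%R ->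
  subordinated f G t = \int[P]_w F (E (t, w)).
Proof.
move=> t0; have [mG G0 GE] := dG t0.
have mEt : measurable_fun [set: T] ((fun w => E (t, w)) : T -> measurableTypeR R).
  exact: (measurableT_comp (measurable_finite_inverse subS) (measurable_pair1 t)).
pose Et : {mfun T >-> measurableTypeR R} :=
  HB.pack (fun w => E (t, w)) (isMeasurableFun.Build _ _ _ _ _ mEt).
transitivity (\int[pushforward P Et]_(x in `]0%R, +oo[) (f x)%:E).
  rewrite (@ge0_integral_of_cdf _ _ (G t))//.
  - by apply: eq_integral => u _; rewrite EFinM muleC.
  - move=> x x0; rewrite /= /pushforward (le_lt_trans (probability_le1 _ _)) ?ltry//.
    rewrite -[X in measurable X]setTI; exact: (mEt measurableT _ (measurable_itv _)).
  - move=> x x0; rewrite -GE ?ltW// /= /pushforward; congr (P _).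
    have Ew w : (`]0%R, x]%classic (E (t, w))) = (0 < t /\ t <= S x w)%R :=
      congr1 (@^~ (t, w)) (finite_inverse_itv subS x0).
    apply/seteqP; split => w.
      by move=> EA; have := EA; rewrite -[X in X -> _]/(`]0%R, x]%classic (E (t, w)))
        Ew => -[_]; rewrite /= (inverse_subordinator_le _ _ _ (ltW x0)).
    rewrite /= (inverse_subordinator_le _ _ _ (ltW x0))// => tS.
    by suff : `]0%R, x]%classic (E (t, w)) by []; rewrite Ew.
  - exact/measurable_EFinP.
rewrite integral_mkcond ge0_integral_pushforward//.
Qed.

Lemma measurable_subordinated :
  measurable_fun (`]0%R, +oo[%classic : set R) (subordinated f G).
Proof.
apply: (@eq_measurable_fun _ _ _ _ _ (fun t => \int[P]_w F (E (t, w)))).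
  by move=> t; rewrite inE/= in_itv/= andbT => t0; rewrite subordinatedE.
apply: measurable_funTS.
exact: (measurable_fun_fubini_tonelli_F (m2 := P) (F \o E) mFE (fun=> F0 _)).
Qed.

Lemma subordinated_ge0 (t : R) : (0 < t)%R -> 0 <= subordinated f G t.
Proof. by move=> t0; rewrite subordinatedE//; exact: integral_ge0. Qed.

(** Both sides are the expectation of [f] at the inverse subordinator taken at
    an independent exponential time. This is the Laplace transform in time of the
    subordinated function. *)
Lemma integral_subordinated (l Phi : R) (l0 : (0 < l)%R) : (0 < Phi)%R ->
  (forall x, (0 < x)%R ->
     'E_P[fun w => expR (- (l * S x w))%R] = (expR (- (x * Phi)))%:E) ->
  \int[exponential_law l0]_(t in `]0%R, +oo[) subordinated f G t =
  \int[mu]_(x in `]0%R, +oo[) ((Phi * expR (- (Phi * x)))%:E * (f x)%:E).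
Proof.
move=> Phi0 Phi_S.
transitivity (\int[exponential_law l0]_t \int[P]_w F (E (t, w))).
  rewrite [LHS]integral_mkcond; apply: eq_integral => t _.
  rewrite patchE; case: ifPn => [|]; rewrite ?inE ?notin_setE/= in_itv/= andbT.
    exact: subordinatedE.
  move=> /negP; rewrite -leNgt => t0; rewrite integral0_eq// => w _.
  rewrite /finite_inverse/= (inverse_subordinator_eq0 subS)//= /F patchE.
  by rewrite memNset//= in_itv/= ltxx.
rewrite -(fubini_tonelli1 (F \o E) mFE (fun=> F0 _)).
transitivity (\int[pushforward (exponential_law l0 \x P) E_mfun]_x F x).
  by rewrite ge0_integral_pushforward.
rewrite /F -integral_mkcond.
have mE := measurable_finite_inverse subS.
apply: ge0_integral_of_cdf => //.
- exact: measurable_exponential_density.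
- by move=> x _; rewrite mulr_ge0 ?expR_ge0// ltW.
- move=> x x0; rewrite /= /pushforward (le_lt_trans (probability_le1 _ _)) ?ltry//.
  by rewrite -[X in measurable X]setTI; exact: (mE measurableT _ (measurable_itv _)).
- move=> x x0; rewrite -(exponential_law_density Phi0)//.
  rewrite (exponential_law_itv Phi0 false (ltW x0)).
  by rewrite -(finite_inverse_exponential_time l0 x0 (Phi_S _ x0)).
- exact/measurable_EFinP.
Qed.

End test_function.

End laplace_in_time.

(** * The Laplace exponent and the Levy kernel *)

Section levy_kernel.
Local Open Scope ereal_scope.
Context {R : realType}.
Variable sigma : {measure set R -> \bar R}.
Hypothesis sigma_min1 : \int[sigma]_(tau in `]0%R, +oo[) (Num.min 1 tau)%R%:E < +oo.
Local Notation mu := (@lebesgue_measure R).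

Let D : set R := `]0%R, +oo[%classic.
Let mD : measurable D. Proof. exact: measurable_itv. Qed.
Let DE x : D x = (0 < x)%R :> Prop.
Proof. by rewrite /D/= in_itv/= andbT. Qed.

Let measurable_min1 (A : set R) : measurable_fun A (fun x : R => Num.min 1%R x).
Proof. by apply: measurable_funTS; exact: measurable_minr. Qed.

Lemma levy_measure_tail_lty (t : R) : (0 < t)%R -> sigma `]t, +oo[%classic < +oo.
Proof.
move=> t0; have m0 : (0 < Num.min 1 t)%R by rewrite lt_min ltr01.
have : (Num.min 1 t)%:E * sigma `]t, +oo[%classic < +oo.
  apply: le_lt_trans sigma_min1; rewrite -integral_cst; last exact: measurable_itv.
  apply: (@le_trans _ _ (\int[sigma]_(x in `]t, +oo[) (Num.min 1 x)%R%:E)).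
    apply: ge0_le_integral => //.
    - by move=> x _; rewrite lee_fin ltW.
    - exact/measurable_EFinP.
    - by move=> x /=; rewrite in_itv/= andbT => /ltW tx; rewrite lee_fin le_min2.
  apply: ge0_subset_integral => //; first exact/measurable_EFinP.
    by move=> x; rewrite -/D DE => x0; rewrite lee_fin le_min ler01 ltW.
  by apply: subset_itvr; rewrite bnd_simp ltW.
have := measure_ge0 sigma `]t, +oo[%classic.
case: (sigma _) => [r| |]//= _; first by rewrite !ltry.
by rewrite gt0_muley// lte_fin.
Qed.

Lemma levy_kernelE (t : R) : (0 < t)%R ->
  (levy_kernel sigma t)%:E = sigma `]t, +oo[%classic.
Proof.
by move=> t0; rewrite /levy_kernel fineK// ge0_fin_numE// levy_measure_tail_lty.
Qed.

(* [sigma] is unrestricted on the negative half-line and may charge 0 with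
   infinite mass, so only its restriction to the positive reals is sigma-finite. *)
Let sigma_finite_restr : sigma_finite setT (mrestr sigma mD).
Proof.
exists (fun n => `]-oo, 0%R]%classic `|` `]n.+1%:R^-1%R, +oo[%classic).
  apply/esym/seteqP; split => // x _.
  have [x0|x0] := leP x 0%R; first by exists 0%N => //; left; rewrite /= in_itv.
  exists (Num.truncn x^-1)%R => //; right; rewrite /= in_itv/= andbT.
  by rewrite invf_plt ?posrE// truncnS_gt.
move=> n; split; first by apply: measurableU; exact: measurable_itv.
rewrite /mrestr setIUl.
rewrite (_ : _ `&` D = set0) ?set0U; last first.
  apply/seteqP; split => // x []; rewrite DE/= in_itv/= => x0.
  by rewrite ltNge x0.
rewrite setIidl; first exact: levy_measure_tail_lty.
by move=> x; rewrite DE/= in_itv/= andbT; exact: lt_trans.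
Qed.

Let m : {sigma_finite_measure set R -> \bar R} :=
  HB.pack (mrestr sigma mD)
    (Measure_isSigmaFinite.Build _ _ _ (mrestr sigma mD) sigma_finite_restr).

Let A : set (measurableTypeR R * R) := [set z | (0 < z.1)%R /\ (z.1 < z.2)%R].

Let mA : measurable A.
Proof.
apply: measurableI.
  rewrite -[X in measurable X]setTI.
  apply: (measurable_fun_ltr _ _ measurableT (Y := [set true])) => //.
rewrite -[X in measurable X]setTI.
by apply: (measurable_fun_ltr _ _ measurableT (Y := [set true])).
Qed.

Let tailE (t : R) : (0 < t)%R -> m (xsection A t) = (levy_kernel sigma t)%:E.
Proof.
move=> t0; rewrite levy_kernelE//= /mrestr; congr (sigma _).
apply/seteqP; split => x; rewrite /xsection /setI /= DE inE/= in_itv/= andbT.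
  by move=> [[]].
by move=> tx; split; [split|exact: lt_trans tx].
Qed.

Lemma measurable_levy_kernel : measurable_fun D (levy_kernel sigma).
Proof.
apply/measurable_EFinP.
apply: (@eq_measurable_fun _ _ _ _ _ (m \o xsection A)).
  by move=> t; rewrite inE DE/= => /tailE.
by apply: measurable_funTS; exact: measurable_fun_xsection.
Qed.

(** Tonelli's theorem on the set of pairs [0 < t < tau]: the section at [t] has
    sigma-mass [levy_kernel sigma t], and the section at [tau] has exponential
    mass [1 - expR (- (l * tau))]. *)
Lemma integral_levy_kernel (l : R) (l0 : (0 < l)%R) :
  \int[exponential_law l0]_(t in D) (levy_kernel sigma t)%:E =
  \int[sigma]_(tau in D) (1 - expR (- (l * tau)))%R%:E.
Proof.
transitivity (\int[exponential_law l0]_t m (xsection A t)).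
  rewrite [LHS]integral_mkcond; apply: eq_integral => t _.
  rewrite patchE; case: ifPn; rewrite ?inE ?notin_setE DE; first by move=> /tailE.
  move=> t0; rewrite (_ : xsection A t = set0) ?measure0//.
  by apply/seteqP; split => // x; rewrite /xsection/= inE => -[].
have := indic_fubini_tonelli (exponential_law l0) m mA.
rewrite (indic_fubini_tonelli_FE m mA) (indic_fubini_tonelli_GE _ mA) => ->.
transitivity (\int[m]_(tau in D) (1 - expR (- (l * tau)))%R%:E); last first.
  by apply: eq_measure_integral => B mB BD; rewrite /= /mrestr setIidl.
rewrite [RHS]integral_mkcond; apply: eq_integral => x _ /=.
rewrite patchE; case: ifPn; rewrite ?inE ?notin_setE DE => x0.
  rewrite -(exponential_law_itv l0 true (ltW x0)); congr (exponential_law l0 _).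
  by apply/seteqP; split => t /=;
    rewrite /ysection/= inE/= in_itv/= => /andP.
rewrite (_ : ysection A x = set0) ?measure0//.
apply/seteqP; split => // t; rewrite /ysection/= inE => -[/= t0 tx].
by apply: x0; exact: lt_trans tx.
Qed.

Hypothesis kernel_gt0 : forall t, (0 < t)%R -> (0 < levy_kernel sigma t)%R.

Lemma laplace_exponent_gt0_lty (l : R) : (0 < l)%R ->
  0 < \int[sigma]_(tau in D) (1 - expR (- (l * tau)))%R%:E < +oo.
Proof.
move=> l0.
have me B : measurable_fun B (fun x : R => (1 - expR (- (l * x)))%R%:E).
  apply/measurable_EFinP/measurable_funTS; apply: measurable_funB => //.
  by apply: measurableT_comp => //; exact: measurableT_comp.
have ge0 x : D x -> 0 <= (1 - expR (- (l * x)))%R%:E.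
  rewrite DE => x0.
  by rewrite lee_fin subr_ge0 -[leRHS]expR0 ler_expR oppr_le0 mulr_ge0// ltW.
apply/andP; split.
  apply: (@lt_le_trans _ _ (\int[sigma]_(tau in `]1%R, +oo[) (1 - expR (- l))%R%:E)).
    rewrite integral_cst; last exact: measurable_itv.
    rewrite -levy_kernelE// -EFinM lte_fin mulr_gt0 ?kernel_gt0//.
    by rewrite subr_gt0 -[ltRHS]expR0 ltr_expR oppr_lt0.
  apply: (@le_trans _ _ (\int[sigma]_(tau in `]1%R, +oo[) (1 - expR (- (l * tau)))%R%:E)).
    apply: ge0_le_integral => //.
    - by move=> x _; rewrite lee_fin subr_ge0 -[leRHS]expR0 ler_expR oppr_le0 ltW.
    - move=> x /=; rewrite in_itv/= andbT => /ltW x1.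
      by rewrite lee_fin lerB// ler_expR lerN2 ler_peMr// ltW.
  apply: ge0_subset_integral => //.
  by move=> x; rewrite DE/= in_itv/= andbT; exact: lt_trans.
apply: (@le_lt_trans _ _ (\int[sigma]_(tau in D) ((1 + l)%:E * (Num.min 1 tau)%R%:E))).
  apply: ge0_le_integral => //.
  - by apply: emeasurable_funM => //; exact/measurable_EFinP.
  - move=> x; rewrite DE => x0; rewrite -EFinM lee_fin.
    (* [1 - e^(-lx)] is below both 1 and [l x]; the factor [1 + l] covers both. *)
    have e1 : (1 - expR (- (l * x)) <= 1)%R by rewrite gerBl expR_ge0.
    have e2 : (1 - expR (- (l * x)) <= l * x)%R.
      by rewrite lerBlDr -lerBlDl; have := expR_ge1Dx (- (l * x))%R.
    by rewrite /Num.min; case: ifPn => _; nra.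
rewrite ge0_integralZl//.
- by rewrite lte_mul_pinfty// lee_fin addr_ge0// ltW.
- exact/measurable_EFinP.
- by move=> x; rewrite DE => x0; rewrite lee_fin le_min ler01 ltW.
- by rewrite lee_fin addr_ge0// ltW.
Qed.

Lemma laplace_exponentE (l : R) : (0 < l)%R ->
  laplace_exponent sigma l = (l * kernel_laplace sigma l)%R.
Proof.
move=> l0; rewrite /laplace_exponent /kernel_laplace /Rintegral.
rewrite -/D -(integral_levy_kernel l0) integral_exponential_law; last 2 first.
- by apply/measurable_EFinP; exact: measurable_levy_kernel.
- by move=> x x0; rewrite lee_fin ltW// kernel_gt0.
rewrite [X in fine X](_ : _ = l%:E *
    \int[mu]_(t in `]0%R, +oo[) (expR (- (l * t)) * levy_kernel sigma t)%R%:E).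
  case: (integral _ _ _) => [r| |]//.
  by rewrite gt0_muley ?lte_fin//= mulr0.
  by rewrite gt0_muleNy ?lte_fin//= mulr0.
rewrite -ge0_integralZl//.
- by apply: eq_integral => t _; rewrite -!EFinM mulrA.
- apply/measurable_EFinP; apply: measurable_funM; last exact: measurable_levy_kernel.
  apply: measurable_funTS.
  by apply: measurableT_comp => //; exact: measurableT_comp.
- move=> x; rewrite -/D DE => x0; rewrite lee_fin mulr_ge0 ?expR_ge0//.
  by rewrite ltW// kernel_gt0.
- by rewrite lee_fin ltW.
Qed.

Lemma laplace_exponent_gt0 (l : R) : (0 < l)%R -> (0 < laplace_exponent sigma l)%R.
Proof.
by move=> l0; rewrite /laplace_exponent fine_gt0// laplace_exponent_gt0_lty.
Qed.

Lemma kernel_laplace_gt0 (l : R) : (0 < l)%R -> (0 < kernel_laplace sigma l)%R.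
Proof.
by move=> l0; have := laplace_exponent_gt0 l0; rewrite laplace_exponentE// pmulr_rgt0.
Qed.

End levy_kernel.

(** * Bernstein approximation of Lipschitz functions *)

Section bernstein.
Context {R : realType}.
Implicit Types (f q : nat -> R) (n : nat) (x : R).

(** The Bernstein operator, by recursion on the degree: the expectation of [f] at
    the number of successes in [n] independent trials of success probability [x],
    conditioned on one of the trials. In this form, induction on [n] shows that a
    class of functions stable under linear combinations and under multiplication
    by the variable contains these polynomials. *)
Fixpoint bernstein n f x : R :=
  if n is m.+1 then
    (1 - x) * bernstein m f x + x * bernstein m (fun k => f k.+1) x
  else f 0%N.

Lemma bernstein_affine n (A c : R) q x :
  bernstein n (fun k => A + c * q k) x = A + c * bernstein n q x.
Proof.
elim: n q => [//|n IHn] q /=.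
by rewrite IHn (IHn (fun k => q k.+1)); ring.
Qed.

Lemma le_bernstein n f q x : 0 <= x <= 1 -> (forall k, f k <= q k) ->
  bernstein n f x <= bernstein n q x.
Proof.
move=> /andP[x0 x1]; elim: n f q => [|n IHn] f q fq /=; first exact: fq.
by apply: lerD; apply: ler_wpM2l; rewrite ?subr_ge0// IHn.
Qed.

(** Variance plus squared bias of the binomial law. *)
Lemma bernstein_sqr n (a : R) x :
  bernstein n (fun k => (k%:R - a) ^+ 2) x =
  n%:R * (x * (1 - x)) + (n%:R * x - a) ^+ 2.
Proof.
elim: n a => [|n IHn] a /=; first by ring.
rewrite IHn.
rewrite (_ : (fun k : nat => _) = fun k => (k%:R - (a - 1)) ^+ 2); last first.
  by apply/funext => k; rewrite -natr1; ring.
by rewrite IHn -natr1; ring.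
Qed.

(** Chebyshev's argument in additive form: a 1-Lipschitz error [u] is at most
    [e / 2 + u ^+ 2 / (2 * e)], and the Bernstein operator is positive, affine and
    known on squares. *)
Lemma bernstein_approx (h : R -> R) (e : R) : 0 < e ->
  (forall x y, `|h x - h y| <= `|x - y|) ->
  exists n, forall x, 0 <= x <= 1 ->
    `|h x - bernstein n (fun k => h (k%:R / n%:R)) x| <= e.
Proof.
move=> e0 hlip; pose n := (Num.truncn (4 * e ^+ 2)^-1).+1.
(* With this [n] the variance term [x (1 - x) / (2 e n)] is at most [e / 2]. *)
exists n => x x01; have /andP[x0 x1] := x01.
have n0 : 0 < n%:R :> R by rewrite ltr0n.
have nE : 1 <= 4 * e ^+ 2 * n%:R.
  rewrite -ler_pdivrMl ?mulr1; last by rewrite mulr_gt0// exprn_gt0.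
  by rewrite ltW// truncnS_gt.
pose c := (2 * e * n%:R ^+ 2)^-1.
have c0 : 0 < c by rewrite invr_gt0 !mulr_gt0// exprn_gt0.
have near_h k : `|h x - h (k%:R / n%:R)| <= e / 2 + c * (k%:R - n%:R * x) ^+ 2.
  apply: le_trans (hlip _ _) _; set u := `| _ |.
  have -> : c * (k%:R - n%:R * x) ^+ 2 = (2 * e)^-1 * u ^+ 2.
    rewrite /u real_normK ?num_real// /c; field.
    by rewrite !gt_eqF.
  rewrite -subr_ge0 (_ : _ - u = (2 * e)^-1 * (e - u) ^+ 2).
    by rewrite mulr_ge0 ?sqr_ge0// invr_ge0 mulr_ge0// ltW.
  by field; rewrite gt_eqF.
set b := bernstein _ _ _.
have bern_e : e / 2 + c * bernstein n (fun k => (k%:R - n%:R * x) ^+ 2) x <= e.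
  rewrite bernstein_sqr subrr expr0n/= addr0.
  have -> : c * (n%:R * (x * (1 - x))) = (2 * e * n%:R)^-1 * (x * (1 - x)).
    by rewrite /c; field; rewrite !gt_eqF.
  rewrite [leRHS]splitr lerD2l ler_pdivrMl ?mulr_gt0//.
  have -> : 2 * e * n%:R * (e / 2) = e ^+ 2 * n%:R by field.
  have x4 : 4 * (x * (1 - x)) <= 1 by rewrite -subr_ge0 (_ : _ - _ = (1 - 2 * x) ^+ 2) ?sqr_ge0//; ring.
  by move: nE; rewrite -mulrA; lra.
rewrite ler_distlC; apply/andP; split.
- have : bernstein n (fun k => (h x - e / 2) + (- c) * (k%:R - n%:R * x) ^+ 2) x <= b.
    apply: le_bernstein => // k; have := near_h k; rewrite ler_distlC.
    by lra.
  by rewrite bernstein_affine; lra.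
- have : b <= bernstein n (fun k => (h x + e / 2) + c * (k%:R - n%:R * x) ^+ 2) x.
    apply: le_bernstein => // k; have := near_h k; rewrite ler_distlC.
    by lra.
  by rewrite bernstein_affine; lra.
Qed.

End bernstein.

(** * Exponential moments determine limits of monotone functions *)

Section moments.
Context {R : realType}.
Variable nu : {finite_measure set (measurableTypeR R) -> \bar R}.
Hypothesis nu_itv_gt0 : forall a b : R, 0 < a -> a < b ->
  (0 < nu `[a, b]%classic)%E.
Let D : set R := `]0, +oo[%classic.
Let mD : @measurable _ (measurableTypeR R) D. Proof. exact: measurable_itv. Qed.
Let DE x : D x = (0 < x) :> Prop.
Proof. by rewrite /D/= in_itv/= andbT. Qed.

Definition exp_integral (W h : R -> R) : R :=
  \int[nu]_(t in D) (h (expR (- t)) * W t).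
Local Notation J := exp_integral.

Let bounded01 (h : R -> R) := exists M : R, forall y : R, 0 <= y <= 1 -> `|h y| <= M.

Let exp01 (t : R) : D t -> 0 <= expR (- t) <= 1.
Proof.
rewrite DE => /ltW t0.
by rewrite expR_ge0/= -[leRHS]expR0 ler_expR oppr_le0.
Qed.

Let integrable_J (W h : R -> R) : nu.-integrable D (EFin \o W) ->
  measurable_fun setT h -> bounded01 h ->
  nu.-integrable D (EFin \o (fun t => h (expR (- t)) * W t)).
Proof.
move=> iW mh [M hM].
have mhe : measurable_fun D (fun t => h (expR (- t))).
  apply: measurable_funTS; apply: (measurableT_comp mh).
  by apply: measurableT_comp => //; exact: measurable_oppr.
have := @integrableMr _ _ _ nu D mD (fun t => h (expR (- t))) (EFin \o W) mhe _ iW.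
apply.
exists M; split; first exact: num_real.
by move=> N MN t Dt; apply: le_trans (ltW MN); apply: hM; exact: exp01.
Qed.

Let J_lin (W h1 h2 : R -> R) (a b : R) : nu.-integrable D (EFin \o W) ->
  measurable_fun setT h1 -> bounded01 h1 ->
  measurable_fun setT h2 -> bounded01 h2 ->
  J W (fun y => a * h1 y + b * h2 y) = a * J W h1 + b * J W h2.
Proof.
move=> iW m1 b1 m2 b2.
have i1 := integrable_J iW m1 b1; have i2 := integrable_J iW m2 b2.
rewrite /J.
under eq_Rintegral do rewrite mulrDl -!mulrA.
rewrite RintegralD//; first by rewrite !RintegralZl.
  by have := integrableZl mD a i1; apply: eq_integrable.
by have := integrableZl mD b i2; apply: eq_integrable.
Qed.

Let le_J (W h1 h2 : R -> R) : nu.-integrable D (EFin \o W) ->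
  (forall t : R, 0 < t -> 0 <= W t) ->
  measurable_fun setT h1 -> bounded01 h1 ->
  measurable_fun setT h2 -> bounded01 h2 ->
  (forall y : R, 0 <= y <= 1 -> h1 y <= h2 y) -> J W h1 <= J W h2.
Proof.
move=> iW W0 m1 b1 m2 b2 h12; apply: le_Rintegral => //; try exact: integrable_J.
by move=> t Dt; rewrite ler_wpM2r// ?h12 ?exp01// W0// -DE.
Qed.

Context {I : Type} (F : set_system I) {FF : ProperFilter F}.
Variables (W : I -> R -> R) (W0 : R -> R).
Hypothesis iW : \forall i \near F, nu.-integrable D (EFin \o W i).
Hypothesis W_ge0 : \forall i \near F, forall t : R, 0 < t -> 0 <= W i t.
Hypothesis W_nd : \forall i \near F, forall t u : R, 0 < t -> t <= u -> W i t <= W i u.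
Hypothesis iW0 : nu.-integrable D (EFin \o W0).
Hypothesis W0_ge0 : forall t : R, 0 < t -> 0 <= W0 t.
Hypothesis W0_cont : {for 1, continuous W0}.
Hypothesis W_moments : forall k : nat,
  J (W i) (fun y => y ^+ k) @[i --> F] --> J W0 (fun y => y ^+ k).

(* Test functions whose integrals converge, together with all their products by
   powers; the latter make the class stable under multiplication by the variable. *)
Let moment_class (h : R -> R) := [/\ measurable_fun setT h, bounded01 h &
  forall k : nat, J (W i) (fun y => y ^+ k * h y) @[i --> F] -->
                  J W0 (fun y => y ^+ k * h y)].

Let mX (k : nat) h : measurable_fun setT h -> bounded01 h ->
  measurable_fun setT (fun y : R => y ^+ k * h y) /\
  bounded01 (fun y : R => y ^+ k * h y).
Proof.
move=> mh [M hM]; split.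
  by apply: measurable_funM => //; exact: measurable_funX.
exists M => y y01; have /andP[y0 y1] := y01.
rewrite normrM ger0_norm ?exprn_ge0// -[leRHS]mul1r ler_pM ?exprn_ge0//.
  by rewrite exprn_ile1.
exact: hM.
Qed.

Let moment_class_lin (h1 h2 : R -> R) (a b : R) :
  moment_class h1 -> moment_class h2 ->
  moment_class (fun y => a * h1 y + b * h2 y).
Proof.
move=> [m1 b1 c1] [m2 b2 c2]; split.
- by apply: measurable_funD; apply: measurable_funM.
- case: b1 => M1 b1; case: b2 => M2 b2; exists (`|a| * M1 + `|b| * M2) => y y01.
  apply: le_trans (ler_normD _ _) _; rewrite !normrM.
  by apply: lerD; apply: ler_wpM2l; rewrite ?b1 ?b2.
- move=> k; have [mk1 bk1] := mX k m1 b1; have [mk2 bk2] := mX k m2 b2.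
  have E (V : R -> R) : nu.-integrable D (EFin \o V) ->
      J V (fun y => y ^+ k * (a * h1 y + b * h2 y)) =
      a * J V (fun y => y ^+ k * h1 y) + b * J V (fun y => y ^+ k * h2 y).
    move=> iV; rewrite -J_lin//; congr (J V _); apply/funext => y; ring.
  rewrite E//.
  have : a * J (W i) (fun y => y ^+ k * h1 y) + b * J (W i) (fun y => y ^+ k * h2 y)
      @[i --> F] --> a * J W0 (fun y => y ^+ k * h1 y) +
                     b * J W0 (fun y => y ^+ k * h2 y).
    by apply: cvgD; apply: cvgM => //; exact: cvg_cst.
  apply: cvg_trans; apply: near_eq_cvg; near=> i; rewrite E//.
  by near: i.
Unshelve. all: by end_near. Qed.

Let moment_class_mul (h : R -> R) : moment_class h ->
  moment_class (fun y => y * h y).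
Proof.
move=> [mh bh ch]; have [m1 b1] := mX 1 mh bh; split => //.
move=> k; have := ch k.+1.
rewrite (_ : (fun y : R => y ^+ k.+1 * h y) = fun y => y ^+ k * (y * h y))//.
by apply/funext => y; rewrite exprSr mulrA.
Qed.

Let moment_class_cst (a : R) : moment_class (fun=> a).
Proof.
suff : moment_class (fun=> 1).
  move=> h1; have := moment_class_lin a 0 h1 h1.
  by rewrite (_ : (fun=> _) = fun=> a)//; apply/funext => y; ring.
split => //; first by exists 1 => y _; rewrite normr1.
move=> k; have := @W_moments k.
by rewrite (_ : (fun y : R => y ^+ k * 1) = fun y => y ^+ k)//; apply/funext => y; rewrite mulr1.
Qed.

Let moment_class_bernstein n (f : nat -> R) : moment_class (bernstein n f).
Proof.
elim: n f => [|n IHn] f /=; first exact: moment_class_cst.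
rewrite (_ : (fun x => _) = fun x => 1 * (1 * bernstein n f x +
   (-1) * (x * bernstein n f x)) +
   1 * (x * bernstein n (fun k => f k.+1) x)); last first.
  by apply/funext => x; ring.
apply: moment_class_lin; last exact: moment_class_mul.
by apply: moment_class_lin => //; exact: moment_class_mul.
Qed.

(* Uniform approximation by Bernstein polynomials; the error is controlled by the
   moment of order 0, which is eventually below its limit plus 1. *)
Let lipschitz_cvg (h : R -> R) : measurable_fun setT h -> bounded01 h ->
  (forall x y, `|h x - h y| <= `|x - y|) ->
  J (W i) h @[i --> F] --> J W0 h.
Proof.
move=> mh bh hlip.
have J1 : J (W i) (fun=> 1) @[i --> F] --> J W0 (fun=> 1).
  by have := @W_moments 0%N; under eq_fun do under eq_fun do rewrite expr0;
    rewrite (_ : (fun y : R => y ^+ 0) = fun=> 1).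
have b1 : bounded01 (fun=> 1) by exists 1 => y _; rewrite normr1.
pose M := J W0 (fun=> 1) + 1.
have J0 : 0 <= J W0 (fun=> 1).
  by apply: Rintegral_ge0 => t; rewrite DE => t0; rewrite mul1r W0_ge0.
have M0 : 0 < M by rewrite ltr_wpDl.
apply/cvgrPdist_le => e e0; pose e' := e / (3 * M).
have e'0 : 0 < e' by rewrite divr_gt0// mulr_gt0.
have [n hn] := bernstein_approx e'0 hlip.
set b := bernstein n _ in hn.
have [mb bb cb] : moment_class b by exact: moment_class_bernstein.
have Jb : J (W i) b @[i --> F] --> J W0 b.
  have := cb 0%N; rewrite (_ : (fun y => y ^+ 0 * b y) = b)//.
  by apply/funext => y; rewrite mul1r.
have approx (V : R -> R) : nu.-integrable D (EFin \o V) ->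
    (forall t : R, 0 < t -> 0 <= V t) -> J V (fun=> 1) <= M ->
    `|J V h - J V b| <= e / 3.
  move=> iV V0 VM.
  have lin (c : R) : J V (fun y => 1 * b y + c * 1) = J V b + c * J V (fun=> 1).
    by rewrite J_lin// mul1r.
  have bdd (c : R) : bounded01 (fun y => 1 * b y + c * 1).
    case: bb => K bK; exists (K + `|c|) => y y01.
    by rewrite mul1r mulr1 (le_trans (ler_normD _ _))// lerD2r bK.
  have mdd (c : R) : measurable_fun setT (fun y => 1 * b y + c * 1).
    by apply: measurable_funD => //; apply: measurable_funM.
  have eM : e' * J V (fun=> 1) <= e / 3.
    apply: (@le_trans _ _ (e' * M)); first by rewrite ler_wpM2l// ltW.
    by rewrite le_eqVlt; apply/orP; left; apply/eqP; rewrite /e'; field; rewrite gt_eqF.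
  rewrite ler_distl; apply/andP; split.
  - apply: (@le_trans _ _ (J V (fun y => 1 * b y + (- e') * 1))).
      by rewrite lin; lra.
    by apply: le_J => // y /hn; rewrite ler_distl; lra.
  - apply: (@le_trans _ _ (J V (fun y => 1 * b y + e' * 1))).
      by apply: le_J => // y /hn; rewrite ler_distl; lra.
    by rewrite lin; lra.
have near_b : \forall i \near F, `|J W0 b - J (W i) b| <= e / 3.
  by move/cvgrPdist_le : Jb; apply; rewrite divr_gt0.
have near_1 : \forall i \near F, J (W i) (fun=> 1) <= M.
  by apply: cvgr_le J1 _ _; rewrite ltrDl.
near=> i.
have ib : `|J W0 b - J (W i) b| <= e / 3 by near: i.
have a0 := approx W0 iW0 W0_ge0 _.
have {}a0 : `|J W0 h - J W0 b| <= e / 3 by apply: a0; rewrite lerDl.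
have ai : `|J (W i) h - J (W i) b| <= e / 3.
  by apply: approx; near: i.
by move: ib a0 ai; rewrite !ler_distl; lra.
Unshelve. all: by end_near. Qed.

(** Carried by [[y1, y2]]. Being 1-Lipschitz whatever its support, it is within
    reach of [bernstein_approx] with no rescaling. *)
Definition tent (y1 y2 y : R) : R := Num.max 0 (Num.min (y - y1) (y2 - y)).

Lemma tent_lipschitz y1 y2 x y : `|tent y1 y2 x - tent y1 y2 y| <= `|x - y|.
Proof.
rewrite /tent /Num.max /Num.min ler_norml.
have := ler_norm (x - y); have := ler_norm (y - x); rewrite distrC => yx xy.
by apply/andP; split; (do 4 case: ifPn); lra.
Qed.

Lemma tent_ge0 y1 y2 y : 0 <= tent y1 y2 y.
Proof. by rewrite /tent le_max lexx. Qed.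

Lemma tent_eq0 y1 y2 y : (y <= y1) || (y2 <= y) -> tent y1 y2 y = 0.
Proof.
move=> yy; rewrite /tent; apply/max_idPl.
by rewrite ge_min !subr_le0.
Qed.

Lemma tent_ge y1 y2 r y : y1 + r <= y -> y <= y2 - r -> r <= tent y1 y2 y.
Proof.
move=> ry yr; rewrite /tent le_max le_min; apply/orP; right.
by apply/andP; split; lra.
Qed.

Let measurable_tent y1 y2 : measurable_fun setT (tent y1 y2).
Proof.
apply: measurable_maxr => //; apply: measurable_minr.
  by apply: measurable_funB.
by apply: measurable_funB.
Qed.

Let bounded_tent y1 y2 : bounded01 (tent y1 y2).
Proof.
exists (1 + `|y2|) => y /andP[y0 y1'].
rewrite ger0_norm ?tent_ge0// /tent ge_max addr_ge0//= ge_min.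
by apply/orP; right; have := ler_norm y2; lra.
Qed.

Let integrable_cst (a : R) : nu.-integrable D (EFin \o (fun=> a)).
Proof. exact: (finite_measure_integrable_cst nu a mD). Qed.

Let tent_mass_gt0 (t1 t2 : R) : 0 < t1 -> t1 < t2 ->
  0 < J (fun=> 1) (tent (expR (- t2)) (expR (- t1))).
Proof.
move=> t10 t12; set h := tent _ _.
(* The middle third of the support, where the tent is at least [r]. *)
pose a := (2 * t1 + t2) / 3; pose b := (t1 + 2 * t2) / 3.
have t1a : t1 < a by rewrite /a; lra.
have ab : a < b by rewrite /a /b; lra.
have bt2 : b < t2 by rewrite /b; lra.
pose r := Num.min (expR (- b) - expR (- t2)) (expR (- t1) - expR (- a)).
have r0 : 0 < r by rewrite lt_min !subr_gt0 !ltr_expR !ltrN2 t1a bt2.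
have hr t : a <= t <= b -> r <= h (expR (- t)).
  move=> /andP[at_ tb].
  have e1 : expR (- b) <= expR (- t) by rewrite ler_expR lerN2.
  have e2 : expR (- t) <= expR (- a) by rewrite ler_expR lerN2.
  have r1 : r <= expR (- b) - expR (- t2) by rewrite ge_min lexx.
  have r2 : r <= expR (- t1) - expR (- a) by rewrite ge_min lexx orbT.
  by apply: tent_ge; lra.
have a0 : 0 < a by apply: lt_trans t1a.
have ih := integrable_J (integrable_cst 1) (measurable_tent (expR (- t2)) (expR (- t1)))
  (bounded_tent _ _).
rewrite /J /Rintegral fine_gt0//; apply/andP; split; last first.
  by have := integrable_fin_num mD ih; rewrite fin_numElt => /andP[].
apply: (@lt_le_trans _ _ (\int[nu]_(t in `[a, b]) r%:E)%E).
  rewrite integral_cst; last exact: measurable_itv.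
  by rewrite mule_gt0 ?lte_fin// nu_itv_gt0.
have mh (A : set R) : measurable_fun A (fun t : R => (h (expR (- t)) * 1)%:E).
  apply/measurable_EFinP/measurable_funTS; apply: measurable_funM => //.
  apply: (measurableT_comp (measurable_tent _ _)).
  by apply: measurableT_comp => //; exact: measurable_oppr.
apply: (@le_trans _ _ (\int[nu]_(t in `[a, b]) (h (expR (- t)) * 1)%:E)%E).
  apply: ge0_le_integral => //.
  - by move=> t _; rewrite lee_fin ltW.
  - exact: mh.
  - by move=> t /=; rewrite in_itv/= lee_fin mulr1; exact: hr.
apply: ge0_subset_integral => //.
- exact: mh.
- by move=> t _; rewrite lee_fin mulr1 tent_ge0.
- by move=> t; rewrite DE/= in_itv/= => /andP[+ _]; exact: lt_le_trans.
Qed.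

Let le_J_tent (V1 V2 : R -> R) (t1 t2 : R) :
  nu.-integrable D (EFin \o V1) -> nu.-integrable D (EFin \o V2) ->
  (forall t, 0 < t -> t1 <= t <= t2 -> V1 t <= V2 t) ->
  J V1 (tent (expR (- t2)) (expR (- t1))) <=
  J V2 (tent (expR (- t2)) (expR (- t1))).
Proof.
move=> iV1 iV2 V12; apply: le_Rintegral => //; try exact: integrable_J.
move=> t; rewrite DE => t0.
have [t12|] := boolP (t1 <= t <= t2); first by rewrite ler_wpM2l ?tent_ge0// V12.
rewrite negb_and -!ltNge => /orP tt.
rewrite tent_eq0 ?mul0r// !ler_expR !lerN2.
by case: tt => /ltW ->; rewrite ?orbT.
Qed.

Let J_cst (a : R) (t1 t2 : R) :
  J (fun=> a) (tent (expR (- t2)) (expR (- t1))) =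
  a * J (fun=> 1) (tent (expR (- t2)) (expR (- t1))).
Proof.
rewrite /J -RintegralZl//; last exact: integrable_J.
by apply: eq_Rintegral => t _; rewrite mulr1 mulrC.
Qed.

(** The tents carried by [[1, 1 + q]] and by [[1 - q, 1]], in the time variable,
    have convergent integrals by [lipschitz_cvg]. By monotonicity [W i 1] times the
    mass of the tent is below the first integral and above the second, and by
    continuity of [W0] at 1 both limits are close to [W0 1] times that mass. *)
Lemma moments_cvg : W i 1 @[i --> F] --> W0 1.
Proof.
apply/cvgrPdist_le => e e0.
have e20 : 0 < e / 2 by rewrite divr_gt0.
have : \forall t \near (1 : R), `|W0 1 - W0 t| <= e / 2.
  by move/cvgrPdist_le : W0_cont; exact.
move=> /nbhs_ballP[r /= r0 rW0].
(* [q <= 1 / 2] keeps the support of the left tent away from 0. *)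
pose q := Num.min (r / 2) 2^-1.
have q0 : 0 < q by rewrite lt_min divr_gt0//= invr_gt0.
have q1 : q <= 2^-1 by rewrite ge_min lexx orbT.
have qr : q <= r / 2 by rewrite ge_min lexx.
have W0q t : 1 - q <= t <= 1 + q -> W0 1 - e / 2 <= W0 t <= W0 1 + e / 2.
  move=> /andP[qt tq]; have : `|W0 1 - W0 t| <= e / 2.
    by apply: rW0; rewrite /ball/= ltr_norml; apply/andP; split; lra.
  by rewrite ler_distl => /andP[? ?]; apply/andP; split; lra.
have q1p : 0 < 1 - q by lra.
have q2 : 1 - q < 1 by lra.
have q3 : 1 < 1 + q by lra.
have up_arith (w v c j0 j : R) : 0 < c -> v * c <= j ->
    j0 <= (w + e / 2) * c -> `|j0 - j| <= e / 2 * c -> v <= w + e.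
  move=> c0 vj j0w; rewrite ler_distl => /andP[jj0 _].
  by rewrite -(ler_pM2r c0); lra.
have lo_arith (w v c j0 j : R) : 0 < c -> j <= v * c ->
    (w - e / 2) * c <= j0 -> `|j0 - j| <= e / 2 * c -> w <= v + e.
  move=> c0 jv wj0; rewrite ler_distl => /andP[_ j0j].
  by rewrite -(ler_pM2r c0); lra.
have near_tent (t1 t2 : R) : 0 < t1 -> t1 < t2 ->
    let h := tent (expR (- t2)) (expR (- t1)) in
    \forall i \near F, `|J W0 h - J (W i) h| <= e / 2 * J (fun=> 1) h.
  move=> t10 t12 h.
  have : J (W i) h @[i --> F] --> J W0 h.
    by apply: (lipschitz_cvg (measurable_tent _ _) (bounded_tent _ _)) => *; exact: tent_lipschitz.
  by move/cvgrPdist_le; apply; rewrite mulr_gt0// tent_mass_gt0.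
pose h_up := tent (expR (- (1 + q))) (expR (- 1)).
pose h_lo := tent (expR (- 1)) (expR (- (1 - q))).
have up : \forall i \near F, `|J W0 h_up - J (W i) h_up| <= e / 2 * J (fun=> 1) h_up.
  exact: near_tent.
have lo : \forall i \near F, `|J W0 h_lo - J (W i) h_lo| <= e / 2 * J (fun=> 1) h_lo.
  exact: near_tent.
have c_up : 0 < J (fun=> 1) h_up by exact: tent_mass_gt0.
have c_lo : 0 < J (fun=> 1) h_lo by exact: tent_mass_gt0.
suff close (V : R -> R) : nu.-integrable D (EFin \o V) ->
    (forall t u : R, 0 < t -> t <= u -> V t <= V u) ->
    `|J W0 h_up - J V h_up| <= e / 2 * J (fun=> 1) h_up ->
    `|J W0 h_lo - J V h_lo| <= e / 2 * J (fun=> 1) h_lo ->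
    `|W0 1 - V 1| <= e.
  have FI := @filterI I F (@filter_filter I F FF).
  have := FI _ _ (FI _ _ iW W_nd) (FI _ _ up lo).
  apply: (@filterS I F (@filter_filter I F FF)) => i [[iWi Wi_nd] [upi loi]].
  exact: close iWi Wi_nd upi loi.
clear up lo near_tent => iV V_nd upi loi.
rewrite ler_distl lerBlDr; apply/andP; split.
- apply: up_arith c_up _ _ upi; rewrite -J_cst; apply: le_J_tent => // t t0 /andP[t1 t2].
    exact: V_nd.
  by have /andP[] := W0q t (introT andP (conj (le_trans (ltW q2) t1) t2)).
- apply: lo_arith c_lo _ _ loi; rewrite -J_cst; apply: le_J_tent => // t t0 /andP[t1 t2].
    exact: V_nd.
  by have /andP[] := W0q t (introT andP (conj t1 (le_trans t2 (ltW q3)))).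
Qed.

End moments.

(** * Scaling of exponential laws, and the Gamma function *)

Section scaling.
Local Open Scope ereal_scope.
Context {R : realType}.
Local Notation mu := (@lebesgue_measure R).

Lemma exponential_law_scale (k l : R) (k0 : (0 < k)%R) (l0 : (0 < l)%R)
    (m : R) (m0 : (0 < m)%R) (g : R -> \bar R) :
  m = (k * l)%R ->
  measurable_fun (`]0%R, +oo[%classic : set R) g ->
  (forall x, (0 < x)%R -> 0 <= g x) ->
  \int[exponential_law k0]_(t in `]0%R, +oo[) g (t / l)%R =
  \int[exponential_law m0]_(t in `]0%R, +oo[) g t.
Proof.
move=> mE mg g0.
have ms : measurable_fun setT ((fun t => t / l)%R : measurableTypeR R -> measurableTypeR R).
  exact: measurable_funM.
pose s : {mfun measurableTypeR R >-> measurableTypeR R} :=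
  HB.pack ((fun t => t / l)%R : measurableTypeR R -> measurableTypeR R)
    (isMeasurableFun.Build _ _ _ _ _ ms).
transitivity (\int[pushforward (exponential_law k0) s]_(t in `]0%R, +oo[) g t).
  rewrite ge0_integral_pushforward//; last first.
    by move=> x; rewrite inE/= in_itv/= andbT; exact: g0.
  rewrite (_ : s @^-1` _ = `]0%R, +oo[%classic)//.
  by apply/seteqP; split => x; rewrite /= !in_itv/= !andbT pmulr_lgt0// invr_gt0.
transitivity (\int[mu]_(t in `]0%R, +oo[) ((m * expR (- (m * t)))%:E * g t));
  last by apply/esym; exact: integral_exponential_law.
apply: ge0_integral_of_cdf => //.
- exact: measurable_exponential_density.
- by move=> x _; rewrite mulr_ge0 ?expR_ge0// ltW.
- move=> x x0; rewrite /= /pushforward (le_lt_trans (probability_le1 _ _)) ?ltry//.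
  by rewrite -[X in measurable X]setTI; exact: (ms measurableT _ (measurable_itv _)).
- move=> x x0; rewrite -(exponential_law_density m0)//.
  have xl : (0 <= x * l)%R by rewrite mulr_ge0// ltW.
  transitivity ((1 - expR (- (k * (x * l))))%R%:E); last first.
    rewrite (exponential_law_itv m0 false (ltW x0)).
    by rewrite mE (_ : (k * (x * l) = k * l * x)%R)// mulrAC mulrA.
  rewrite -(exponential_law_itv k0 false xl) /= /pushforward.
  congr (exponential_law k0 _).
  by apply/seteqP; split => t; rewrite /= !in_itv/= ler_pdivrMr// pmulr_lgt0 ?invr_gt0//.
Qed.

Lemma exponential_law_itvcc_gt0 (k a b : R) (k0 : (0 < k)%R) :
  (0 < a)%R -> (a < b)%R -> 0 < exponential_law k0 `[a, b]%classic.
Proof.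
move=> a0 ab; have b0 : (0 < b)%R by exact: lt_trans ab.
have : exponential_law k0 `]0%R, b]%classic <=
    exponential_law k0 `]0%R, a]%classic + exponential_law k0 `[a, b]%classic.
  apply: le_trans (measureU2 _ _ _); try exact: measurable_itv.
  apply: le_measure; rewrite ?inE; try exact: measurable_itv.
    by apply: measurableU; exact: measurable_itv.
  move=> x; rewrite /= !in_itv/= => /andP[x0 xb].
  by case: (leP x a) => xa; [left; rewrite x0|right; rewrite ltW].
rewrite (exponential_law_itv k0 false (ltW b0)) (exponential_law_itv k0 false (ltW a0)).
have : (expR (- (k * b)) < expR (- (k * a)))%R.
  by rewrite ltr_expR ltrN2 ltr_pM2l.
case: (exponential_law k0 `[a, b]%classic) => [r| |]//=.
by rewrite -EFinD lee_fin lte_fin; lra.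
Qed.

(** An exponential moment of order [k] for rate 1 is a plain integral for rate
    [k + 1], which turns moments into values of a Laplace transform. *)
Lemma integral_exp_moment (k : nat) (k0 : (0 < k.+1%:R :> R)%R) (V : R -> R) :
  measurable_fun (`]0%R, +oo[%classic : set R) V ->
  (forall x, (0 < x)%R -> (0 <= V x)%R) ->
  \int[exponential_law (@ltr01 R)]_(t in `]0%R, +oo[) (expR (- t) ^+ k * V t)%R%:E =
  (k.+1%:R^-1)%R%:E * \int[exponential_law k0]_(t in `]0%R, +oo[) (V t)%:E.
Proof.
move=> mV V0.
have mk (A : set R) : measurable_fun A (fun t : R => (expR (- t) ^+ k)%R).
  apply: measurable_funTS; apply: measurable_funX.
  by apply: measurableT_comp => //; exact: measurable_oppr.
rewrite integral_exponential_law; last 2 first.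
- by apply/measurable_EFinP; apply: measurable_funM.
- by move=> x x0; rewrite lee_fin mulr_ge0 ?V0// exprn_ge0 ?expR_ge0.
rewrite integral_exponential_law; last 2 first.
- exact/measurable_EFinP.
- by move=> x x0; rewrite lee_fin V0.
rewrite -ge0_integralZl//.
- apply: eq_integral => t _; rewrite -!EFinM; congr EFin.
  rewrite !mulrA mul1r mul1r mulVf ?mul1r//; congr (_ * _)%R.
  by rewrite -expRM_natl -expRD -natr1 mulrDl mul1r; congr expR; ring.
- apply: emeasurable_funM; last exact/measurable_EFinP.
  by apply/measurable_EFinP; exact: measurable_exponential_density.
- move=> x /=; rewrite in_itv/= andbT => x0.
  by rewrite -EFinM lee_fin !mulr_ge0 ?V0 ?expR_ge0.
Qed.

End scaling.

Section gamma.
Context {R : realType}.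
Local Notation mu := (@lebesgue_measure R).

Lemma measurable_powR_itv (r : R) (A : set R) : measurable_fun A (fun t => t `^ r).
Proof. by apply: measurable_funTS; exact: measurable_powR. Qed.

(** The bound that makes the Gamma integral finite; from [ln u <= u - 1] at
    [u = q * t], with [q] small enough that [r * q <= 1 / 2]. *)
Lemma powR_le_expR (r : R) : 0 <= r ->
  exists C : R, forall t, 0 < t -> t `^ r <= C * expR (t / 2).
Proof.
move=> r0; pose q := (2 * (r + 1))^-1.
have q0 : 0 < q by rewrite invr_gt0 mulr_gt0// ltr_wpDl.
exists (expR (- r * ln q)) => t t0.
rewrite /powR gt_eqF// -expRD ler_expR.
have qt0 : 0 < q * t by rewrite mulr_gt0.
have : ln (q * t) <= q * t - 1.
  by have := @le_ln1Dx _ (q * t - 1); rewrite addrCA subrr addr0; apply; lra.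
rewrite lnM ?posrE// => lnqt.
have lnt : ln t <= q * t - ln q by lra.
have rq : r * q <= 2^-1.
  rewrite /q ler_pdivrMr ?mulr_gt0 ?ltr_wpDl//; lra.
have := ler_wpM2l r0 lnt.
have : r * q * t <= 2^-1 * t by rewrite ler_wpM2r// ltW.
lra.
Qed.

Let nu := exponential_law (@ltr01 R).
Let D : set R := `]0, +oo[%classic.
Let mD : @measurable _ (measurableTypeR R) D. Proof. exact: measurable_itv. Qed.
Let DE x : D x = (0 < x) :> Prop.
Proof. by rewrite /D/= in_itv/= andbT. Qed.

Lemma integral_powR_gamma (r : R) : 0 <= r ->
  (\int[nu]_(t in D) (t `^ r)%:E = (Gamma (r + 1))%:E)%E.
Proof.
move=> r0; rewrite integral_exponential_law; last 2 first.
- by apply/measurable_EFinP; exact: measurable_powR_itv.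
- by move=> x x0; rewrite lee_fin powR_ge0.
have -> : (\int[mu]_(t in D) ((1 * expR (- (1 * t)))%:E * (t `^ r)%:E) =
    \int[mu]_(t in D) (t `^ (r + 1 - 1) * expR (- t))%:E)%E.
  by apply: eq_integral => t _; rewrite -EFinM addrK !mul1r mulrC.
rewrite /Gamma /Rintegral fineK//.
have mg (A : set R) : measurable_fun A (fun t => (t `^ (r + 1 - 1) * expR (- t))%:E).
  apply/measurable_EFinP; apply: measurable_funM; first exact: measurable_powR_itv.
  apply: measurable_funTS.
  by apply: measurableT_comp => //; exact: measurable_oppr.
rewrite ge0_fin_numE; last first.
  by apply: integral_ge0 => t _; rewrite lee_fin mulr_ge0 ?powR_ge0 ?expR_ge0.
have [C tC] := powR_le_expR r0.
have C0 : 0 <= C.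
  have := tC 1 ltr01; rewrite powR1 => C1.
  by rewrite -(pmulr_lge0 _ (expR_gt0 (1 / 2))) (le_trans _ C1).
have h0 : 0 < 2^-1 :> R by rewrite invr_gt0.
apply: (@le_lt_trans _ _ (\int[exponential_law h0]_(t in D) (2 * C)%:E)%E); last first.
  rewrite integral_cst// lte_mul_pinfty ?lee_fin ?mulr_ge0//.
  by rewrite (le_lt_trans (probability_le1 _ _)) ?ltry.
rewrite integral_exponential_law; last 2 first.
- exact: measurable_cst.
- by move=> x _; rewrite lee_fin mulr_ge0.
apply: ge0_le_integral => //.
- by move=> t _; rewrite lee_fin mulr_ge0 ?powR_ge0 ?expR_ge0.
- exact: mg.
- by apply: emeasurable_funM => //; apply/measurable_EFinP; exact: measurable_exponential_density.
- move=> t Dt; have t0 : 0 < t by rewrite -DE.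
  rewrite -EFinM lee_fin addrK.
  have -> : 2^-1 * expR (- (2^-1 * t)) * (2 * C) = C * expR (t / 2) * expR (- t).
    have -> : - (2^-1 * t) = t / 2 + - t by field.
    by rewrite expRD; field.
  by rewrite ler_wpM2r ?expR_ge0// tC.
Qed.

Lemma gamma_gt0 (r : R) : 0 <= r -> 0 < Gamma (r + 1).
Proof.
move=> r0; rewrite -lte_fin -integral_powR_gamma//.
apply: (@lt_le_trans _ _ (\int[nu]_(t in `[1%R, 2%R]) 1%:E)%E).
  rewrite integral_cst; last exact: measurable_itv.
  by rewrite mul1e exponential_law_itvcc_gt0// ltr1n.
apply: (@le_trans _ _ (\int[nu]_(t in `[1%R, 2%R]) (t `^ r)%:E)%E).
  apply: ge0_le_integral => //.
  - by apply/measurable_EFinP; exact: measurable_powR_itv.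
  - move=> t; rewrite /= in_itv/= => /andP[t1 _].
    have -> : (1 : R) = 1 `^ r by rewrite powR1.
    by rewrite lee_fin ge0_ler_powR ?nnegrE// (le_trans ler01).
apply: ge0_subset_integral => //.
- by apply/measurable_EFinP; exact: measurable_powR_itv.
- by move=> t _; rewrite lee_fin powR_ge0.
- by move=> t; rewrite DE/= in_itv/= => /andP[+ _]; exact: lt_le_trans.
Qed.

(** By scaling, the Laplace transform of [t `^ r] at [k + 1]; these are the limit
    moments in Karamata's theorem. *)
Lemma powR_moment (r : R) (k : nat) : 0 <= r ->
  (\int[nu]_(t in D) (expR (- t) ^+ k * t `^ r)%:E =
   (k.+1%:R^-1 * (k.+1%:R `^ (- r) * Gamma (r + 1)))%:E)%E.
Proof.
move=> r0; have k0 : 0 < k.+1%:R :> R by rewrite ltr0n.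
rewrite (integral_exp_moment k0); last 2 first.
- exact: measurable_powR_itv.
- by move=> x _; exact: powR_ge0.
rewrite -(@exponential_law_scale _ 1 k.+1%:R ltr01 k0 _ k0 (fun t => (t `^ r)%:E)); last 3 first.
- by rewrite mul1r.
- by apply/measurable_EFinP; exact: measurable_powR_itv.
- by move=> x _; rewrite lee_fin powR_ge0.
rewrite EFinM; congr (_ * _)%E.
rewrite EFinM -integral_powR_gamma// -ge0_integralZl//.
- apply: eq_integral => t; rewrite inE/= in_itv/= andbT => /ltW t0.
  by rewrite -EFinM powRM// ?invr_ge0// -(powR_inv1 (ltW k0)) -powRrM mulN1r mulrC.
- by apply/measurable_EFinP; exact: measurable_powR_itv.
- by move=> x _; rewrite lee_fin powR_ge0.
Qed.

End gamma.

(** * Karamata's Tauberian theorem *)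

Section karamata.
Context {R : realType}.
Let D : set R := `]0, +oo[%classic.
Let mD : @measurable _ (measurableTypeR R) D. Proof. exact: measurable_itv. Qed.
Let DE x : D x = (0 < x) :> Prop.
Proof. by rewrite /D/= in_itv/= andbT. Qed.

Lemma continuous_powR (r x : R) : 0 < x -> {for x, continuous (fun t => t `^ r)}.
Proof.
move=> x0; rewrite /continuous_at.
have e : \forall t \near x, expR (r * ln t) = t `^ r.
  near=> t; rewrite /powR gt_eqF//; near: t; exact: lt_nbhsr.
have H : expR (r * ln t) @[t --> x] --> expR (r * ln x).
  apply: continuous_comp; last exact: continuous_expR.
  by apply: cvgM; [exact: cvg_cst|exact: continuous_ln].
have E : expR (r * ln x) = x `^ r by rewrite /powR gt_eqF.
by move: H; rewrite E; apply: cvg_trans; exact: near_eq_cvg.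
Unshelve. all: by end_near. Qed.

(** Rescale: the functions [W l t = U (t / l) / omega l] are nondecreasing, and
    their exponential moment of order [k] is
    [omega ((k + 1) * l) / ((k + 1) * omega l)]. By regular variation this tends
    to the corresponding moment of [t `^ rho / Gamma (rho + 1)], and
    [moments_cvg] gives the limit of [W l 1]. Working with the monotone [U] rather
    than with the measure whose distribution function it is treats [rho = 0] on
    the same footing, since the limit is then the constant 1. *)
Theorem karamata_tauberian (U omega : R -> R) (rho : R) : 0 <= rho ->
  measurable_fun D U ->
  (forall t, 0 < t -> 0 <= U t) ->
  (forall t u, 0 < t -> t <= u -> U t <= U u) ->
  (forall l (l0 : 0 < l),
     (\int[exponential_law l0]_(t in D) (U t)%:E = (omega l)%:E)%E) ->
  (\forall l \near 0^'+, 0 < omega l) ->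
  (forall k : nat,
     omega (k.+1%:R * l) / omega l @[l --> 0^'+] --> k.+1%:R `^ (- rho)) ->
  U l^-1 / omega l @[l --> 0^'+] --> (Gamma (rho + 1))^-1.
Proof.
move=> rho0 mU U0 U_nd Uomega omega0 omega_rv.
pose nu := exponential_law (@ltr01 R).
have G0 := gamma_gt0 rho0.
pose W (l t : R) := (omega l)^-1 * U (t / l).
pose W0 (t : R) := (Gamma (rho + 1))^-1 * t `^ rho.
have mUl (l : R) : 0 < l -> measurable_fun D (fun t => U (t / l)).
  move=> l0.
  have ms : measurable_fun setT ((fun t => t / l) : R -> R) by exact: measurable_funM.
  have Dl : (fun t => t / l) @` D `<=` D.
    by move=> _ [t t0 <-]; move: t0; rewrite !DE => t0; rewrite divr_gt0.
  exact: (measurable_comp (measurable_itv _) Dl mU (measurable_funTS ms)).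
have moment_W (l : R) (k : nat) : 0 < l ->
    (\int[nu]_(t in D) (expR (- t) ^+ k * U (t / l))%:E =
     (k.+1%:R^-1 * omega (k.+1%:R * l))%:E)%E.
  move=> l0; have k0 : 0 < k.+1%:R :> R by rewrite ltr0n.
  have kl0 : 0 < k.+1%:R * l by rewrite mulr_gt0.
  rewrite (integral_exp_moment k0); last 2 first.
  - exact: mUl.
  - by move=> t t0; rewrite U0// divr_gt0.
  rewrite (exponential_law_scale k0 l0 kl0 (g := fun t => (U t)%:E))//.
  - by rewrite Uomega EFinM.
  - exact/measurable_EFinP.
have JE (V : R -> R) (c m : R) (k : nat) : (\int[nu]_(t in D) (expR (- t) ^+ k * V t)%:E = m%:E)%E ->
   measurable_fun D V -> (forall t, 0 < t -> 0 <= V t) ->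
   exp_integral nu (fun t => c * V t) (fun y => y ^+ k) = c * m.
  move=> Vm mV V0; rewrite /exp_integral.
  have mkV : measurable_fun D (fun t => expR (- t) ^+ k * V t).
    apply: measurable_funM => //; apply: measurable_funTS; apply: measurable_funX.
    by apply: measurableT_comp => //; exact: measurable_oppr.
  rewrite -[m]/(fine m%:E) -Vm -RintegralZl//.
    by apply: eq_Rintegral => t _; rewrite mulrCA.
  apply/integrableP; split; first exact/measurable_EFinP.
  apply: (@le_lt_trans _ _ m%:E); last by rewrite ltry.
  rewrite -Vm le_eqVlt; apply/orP; left; apply/eqP; apply: eq_integral => t.
  rewrite inE DE => t0.
  by rewrite /= ger0_norm// mulr_ge0 ?V0// exprn_ge0 ?expR_ge0.
have int0 (V : R -> R) (c m : R) : (\int[nu]_(t in D) (expR (- t) ^+ 0 * V t)%:E = m%:E)%E ->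
   measurable_fun D V -> (forall t, 0 < t -> 0 <= V t) ->
   nu.-integrable D (EFin \o (fun t => c * V t)).
  move=> Vm mV V0.
  have : nu.-integrable D (EFin \o V).
    apply/integrableP; split; first exact/measurable_EFinP.
    apply: (@le_lt_trans _ _ m%:E); last by rewrite ltry.
    rewrite -Vm le_eqVlt; apply/orP; left; apply/eqP; apply: eq_integral => t.
    by rewrite inE DE => t0; rewrite expr0 mul1r /= ger0_norm// V0.
  by move=> /(integrableZl mD c); apply: eq_integrable.
have pos := @nbhs_right_gt R 0.
have FR := at_right_proper_filter (0 : R).
have -> : (Gamma (rho + 1))^-1 = W0 1 by rewrite /W0 powR1 mulr1.
suff : W l 1 @[l --> 0^'+] --> W0 1.
  apply: cvg_trans; apply: near_eq_cvg; near=> l.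
  by rewrite /W div1r mulrC.
apply: (@moments_cvg _ nu).
- by move=> a b a0 ab; exact: exponential_law_itvcc_gt0.
- near=> l; have l0 : 0 < l by near: l.
  apply: (int0 _ _ _ (moment_W l 0%N l0)); first exact: mUl.
  by move=> t t0; rewrite U0// divr_gt0.
- near=> l; have l0 : 0 < l by near: l.
  have ol0 : 0 < omega l by near: l.
  move=> t t0; apply: mulr_ge0; last by rewrite U0// divr_gt0.
  by rewrite invr_ge0 ltW.
- near=> l; have l0 : 0 < l by near: l.
  have ol0 : 0 < omega l by near: l.
  move=> t u t0 tu; apply: ler_wpM2l; first by rewrite invr_ge0 ltW.
  by apply: U_nd; rewrite ?divr_gt0// ler_pM2r ?invr_gt0.
- apply: (int0 _ _ _ (powR_moment 0 rho0)); first exact: measurable_powR_itv.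
  by move=> t _; exact: powR_ge0.
- by move=> t t0; rewrite mulr_ge0 ?powR_ge0// invr_ge0 ltW.
- by apply: cvgM; [exact: cvg_cst|exact: continuous_powR].
- move=> k.
  rewrite (JE _ _ _ _ (powR_moment k rho0)); last 2 first.
  + exact: measurable_powR_itv.
  + by move=> t _; exact: powR_ge0.
  have cancel_gamma (c p : R) :
      (Gamma (rho + 1))^-1 * (c * (p * Gamma (rho + 1))) = c * p.
    by rewrite mulrC -!mulrA divff ?gt_eqF// mulr1.
  rewrite cancel_gamma.
  have : k.+1%:R^-1 * (omega (k.+1%:R * l) / omega l) @[l --> 0^'+] -->
      k.+1%:R^-1 * k.+1%:R `^ (- rho).
    by apply: cvgM; [exact: cvg_cst|exact: omega_rv].
  apply: cvg_trans; apply: near_eq_cvg; near=> l; have l0 : 0 < l by near: l.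
  rewrite (JE _ _ _ _ (moment_W l k l0)); last 2 first.
  + exact: mUl.
  + by move=> t t0; rewrite U0// divr_gt0.
  have comm3 (a b c : R) : a * (b / c) = c^-1 * (a * b) by rewrite mulrA mulrC.
  by rewrite comm3.
Unshelve. all: by end_near. Qed.

End karamata.

(** * Laplace transform of a primitive *)

Section primitive.
Local Open Scope ereal_scope.
Context {R : realType}.
Local Notation mu := (@lebesgue_measure R).
Let D : set R := `]0%R, +oo[%classic.
Let mD : @measurable _ (measurableTypeR R) D. Proof. exact: measurable_itv. Qed.
Let DE x : D x = (0 < x)%R :> Prop.
Proof. by rewrite /D/= in_itv/= andbT. Qed.

Lemma exponential_law_tail (l : R) (l0 : (0 < l)%R) (r : R) : (0 < r)%R ->
  exponential_law l0 `]r, +oo[%classic = (expR (- (l * r)))%:E.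
Proof.
move=> r0.
have tail_oo : exponential_law l0 `]-oo, r]%classic = (1 - expR (- (l * r)))%:E.
  rewrite (_ : `]-oo, r]%classic = `]-oo, 0%R[%classic `|` `[0%R, r]%classic); last first.
    apply/seteqP; split => x; rewrite /= !in_itv/=.
      by move=> xr; case: (ltP x 0%R) => x0; [left|right].
    by case=> [x0|/andP[]//]; rewrite ltW// (lt_trans x0).
  rewrite measureU; try exact: measurable_itv; last first.
    apply/seteqP; split => // x []; rewrite /= !in_itv/= => x0 /andP[].
    by rewrite leNgt x0.
  rewrite [X in X + _](_ : _ = 0) ?add0e; last first.
    rewrite -[LHS]/(exponential_prob l _) /exponential_prob integral0_eq// => x.
    by rewrite /= in_itv/= => x0; rewrite lt0_exponential_pdf.
  by rewrite -[LHS]/(exponential_prob l _) exponential_prob_itv0c// mulNr.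
rewrite -setCitvl probability_setC; last exact: measurable_itv.
by rewrite tail_oo -EFinB subKr.
Qed.

Variable h : R -> \bar R.
Hypotheses (mh : measurable_fun D h) (h0 : forall x, (0 < x)%R -> 0 <= h x).

Let hD := h \_ D.
Let mhD : measurable_fun setT hD. Proof. exact/(measurable_restrictT _ _).1. Qed.
Let hD0 x : 0 <= hD x.
Proof. by rewrite /hD patchE; case: ifPn => //; rewrite inE DE => /h0. Qed.

Let A : set (measurableTypeR R * measurableTypeR R) := [set z | (z.2 < z.1)%R].
Let mA : measurable A.
Proof.
rewrite -[X in measurable X]setTI.
by apply: (measurable_fun_ltr _ _ measurableT (Y := [set true])).
Qed.

Let F (z : measurableTypeR R * measurableTypeR R) := hD z.2 * (\1_A z)%:E.
Let mF : measurable_fun setT F.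
Proof.
apply: emeasurable_funM; first exact: measurableT_comp mhD measurable_snd.
by apply/measurable_EFinP; exact: measurable_indic.
Qed.
Let F0 z : 0 <= F z. Proof. by rewrite mule_ge0// lee_fin. Qed.

Let primitiveE (t : R) :
  \int[mu]_(r in `]0%R, t[) h r = \int[mu]_r F (t, r).
Proof.
rewrite [LHS]integral_mkcond; apply: eq_integral => r _.
rewrite /F /hD !patchE indicE /= mem_setE.
have -> : ((t, r) \in A) = (r < t)%R by apply/idP/idP; rewrite inE.
have -> : (r \in D) = (0 < r)%R by apply/idP/idP; rewrite inE DE.
rewrite in_itv/=.
by case: (0 < r)%R; case: (r < t)%R; rewrite /= ?mule1 ?mule0 ?mul0e.
Qed.

Lemma measurable_primitive :
  measurable_fun D (fun t => \int[mu]_(r in `]0%R, t[) h r).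
Proof.
apply: (@eq_measurable_fun _ _ _ _ _ (fun t => \int[mu]_r F (t, r))).
  by move=> t _; rewrite primitiveE.
apply: measurable_funTS.
exact: (measurable_fun_fubini_tonelli_F (m2 := mu) F mF F0).
Qed.

(** Tonelli's theorem on the set of pairs [r < t]: an exponential time of rate [l]
    exceeds [r] with probability [expR (- (l * r))]. *)
Lemma integral_primitive (l : R) (l0 : (0 < l)%R) :
  \int[exponential_law l0]_(t in D) \int[mu]_(r in `]0%R, t[) h r =
  \int[mu]_(r in D) ((expR (- (l * r)))%:E * h r).
Proof.
transitivity (\int[exponential_law l0]_t \int[mu]_r F (t, r)).
  rewrite [LHS]integral_mkcond; apply: eq_integral => t _.
  rewrite patchE primitiveE; case: ifPn => //; rewrite notin_setE DE => t0.
  rewrite integral0_eq// => r _; rewrite /F /hD patchE indicE.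
  case: ifPn; rewrite ?mul0e// inE DE => r0.
  rewrite memNset ?mule0// /A/= => rt.
  by apply: t0; exact: lt_trans rt.
rewrite (fubini_tonelli F mF F0).
rewrite [RHS]integral_mkcond; apply: eq_integral => r _.
rewrite patchE; case: ifPn => Dr; last first.
  by rewrite integral0_eq// => t _; rewrite /F /hD patchE (negbTE Dr) mul0e.
have r0 : (0 < r)%R by move: Dr; rewrite inE DE.
have hDr : hD r = h r by rewrite /hD patchE Dr.
rewrite /F /= hDr.
rewrite ge0_integralZl//; last 2 first.
- apply/measurable_EFinP.
  by apply: measurableT_comp (measurable_indic mA) _; exact: measurable_pair2.
- exact: h0.
rewrite muleC; congr (_ * _).
rewrite -(exponential_law_tail l0 r0).
transitivity (\int[exponential_law l0]_t (\1_(`]r, +oo[%classic) t)%:E); last first.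
  by rewrite integral_indic// setIT.
apply: eq_integral => t _; congr (_%:E).
rewrite !indicE; congr (nat_of_bool _)%:R.
by apply/idP/idP; rewrite !inE /A /= in_itv/= andbT.
Qed.

(** A primitive is finite as soon as the transform is, since [expR (- (l * r))] is
    bounded below on [`]0, t[]. *)
Lemma primitive_le (l : R) (t : R) : (0 < l)%R -> (0 < t)%R ->
  \int[mu]_(r in `]0%R, t[) h r <=
  (expR (l * t))%:E * \int[mu]_(r in D) ((expR (- (l * r)))%:E * h r).
Proof.
move=> l0 t0.
have me (B : set R) : measurable_fun B (fun r : R => (expR (- (l * r)))%:E).
  apply/measurable_EFinP/measurable_funTS.
  by apply: measurableT_comp => //; exact: measurableT_comp.
rewrite -ge0_integralZl//; last 2 first.
- exact: emeasurable_funM (me D) mh.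
- by move=> r; rewrite DE => r0; rewrite mule_ge0 ?h0// lee_fin expR_ge0.
have tD : `]0%R, t[%classic `<=` D by move=> r; rewrite DE /= in_itv/= => /andP[].
have mh' B : B `<=` D -> measurable_fun B h by move=> /measurable_funS; apply.
apply: (@le_trans _ _ (\int[mu]_(r in `]0%R, t[)
    ((expR (l * t))%:E * ((expR (- (l * r)))%:E * h r)))).
  apply: ge0_le_integral => //.
  - by move=> r /tD; rewrite DE; exact: h0.
  - exact: mh'.
  - by apply: emeasurable_funM => //; exact: emeasurable_funM (me _) (mh' _ tD).
  - move=> r; rewrite /= in_itv/= => /andP[r0 rt].
    rewrite muleA -EFinM -expRD -[leLHS]mul1e lee_wpmul2r ?h0//.
    rewrite lee_fin -[leLHS]expR0 ler_expR -mulrBr.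
    by rewrite mulr_ge0 ?subr_ge0// ltW.
apply: ge0_subset_integral => //.
- by apply: emeasurable_funM => //; exact: emeasurable_funM (me D) mh.
- move=> r; rewrite DE => r0.
  by rewrite !mule_ge0 ?h0// lee_fin expR_ge0.
Qed.

End primitive.

(** * Cesaro means of subordinated functions *)

Section limits.
Context {R : realType}.
Local Notation mu := (@lebesgue_measure R).
Let D : set R := `]0, +oo[%classic.
Let mD : measurable D. Proof. exact: measurable_itv. Qed.
Let DE x : D x = (0 < x) :> Prop.
Proof. by rewrite /D/= in_itv/= andbT. Qed.

(** Times tending to infinity are exchanged with rates tending to 0 from the
    right. *)
Lemma cvgV_pinfty_at_right : (t : R)^-1 @[t --> +oo] --> 0^'+.
Proof.
have t0 : \forall t \near +oo, 0 < (t : R) by exact: nbhs_pinfty_gt.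
have V0 : (fun t : R => t^-1) x @[x --> +oo] --> (0 : R).
  by have := (@gtr0_cvgV0 R R (pinfty_nbhs R) _ id t0).2; apply; exact: cvg_id.
move=> A; rewrite /at_right => /V0.
apply: filter_app; near=> t; apply; near: t.
by apply: filterS t0 => t t0; rewrite /= ?invr_gt0.
Unshelve. all: by end_near. Qed.

Lemma cvgV_at_right_pinfty : (l : R)^-1 @[l --> 0^'+] --> +oo.
Proof.
have l0 : \forall l \near 0^'+, 0 < (l : R) by exact: nbhs_right_gt.
have := (@cvgrVy R R (at_right (0 : R)) (at_right_proper_filter (0 : R)) id l0).2; apply.
by apply: cvg_at_right_filter; exact: cvg_id.
Qed.

Lemma cvgMl_at_right (m : R) : 0 < m -> m * l @[l --> 0^'+] --> 0^'+.
Proof.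
move=> m0.
have l0 : \forall l \near 0^'+, 0 < (l : R) by exact: nbhs_right_gt.
have M0 : m * l @[l --> 0^'+] --> (0 : R).
  apply: cvg_at_right_filter; rewrite -[X in _ --> X](mulr0 m).
  by apply: cvgM; [exact: cvg_cst|exact: cvg_id].
move=> A; rewrite /at_right => /M0.
apply: filter_app; near=> l; apply; near: l.
by apply: filterS l0 => l l0; rewrite /= ?mulr_gt0.
Unshelve. all: by end_near. Qed.

(** Slow variation of [x `^ (- rho) * K x^-1] at infinity, read at [x = l^-1] with
    dilation factor [c^-1]. *)
Lemma regular_variation_at_right (K : R -> R) (rho c : R) : 0 < c ->
  (forall l, 0 < l -> 0 < K l) ->
  slowly_varying (fun x => x `^ (- rho) * K x^-1) ->
  K (c * l) / K l @[l --> 0^'+] --> c `^ (- rho).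
Proof.
move=> c0 K0 /(_ c^-1); rewrite invr_gt0 => /(_ c0) sv.
have /= H := cvg_comp _ _ cvgV_at_right_pinfty sv.
have cV : c `^ (- rho) * (c^-1) `^ (- rho) = 1.
  by rewrite -powRM ?invr_ge0 ?(ltW c0)// divff ?gt_eqF// powR1.
rewrite -[X in _ --> X]mulr1.
apply: cvg_trans (cvgM (cvg_cst (c `^ (- rho))) H); apply: near_eq_cvg.
near=> l; have l0 : 0 < l by near: l; exact: nbhs_right_gt.
rewrite /= powRM ?invr_ge0 ?(ltW c0) ?(ltW l0)// invfM !invrK.
have p0 : (l^-1) `^ (- rho) != 0 by rewrite gt_eqF// powR_gt0// invr_gt0.
have Kl : K l != 0 by rewrite gt_eqF// K0.
move: cV p0; set p := _ `^ _; set q := _ `^ _; set r := _ `^ _ => cV p0.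
rewrite (_ : p * (q * r * K (c * l) / (r * K l)) = (p * q) * (K (c * l) / K l)).
  by rewrite cV mul1r.
by field; rewrite ?Kl ?p0.
Unshelve. all: by end_near. Qed.

Lemma laplace_cvg0 (f p : R -> R) :
  mu.-integrable D (EFin \o f) -> (forall x, 0 < x -> 0 <= f x) ->
  (forall l, 0 < l -> 0 <= p l) -> p l @[l --> 0^'+] --> 0 ->
  \int[mu]_(x in D) (expR (- (p l * x)) * f x) @[l --> 0^'+] -->
  \int[mu]_(x in D) f x.
Proof.
move=> fi f0 p0 pcvg; apply/cvg_at_rightP => u [u0 ucvg].
have pu : p (u n) @[n --> \oo] --> 0 by move/cvg_at_rightP : pcvg; apply.
have mf := measurable_int _ fi.
apply: fine_cvg; rewrite fineK; last exact: integrable_fin_num fi.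
apply: (@dominated_cvg _ _ _ mu D mD _ _ (EFin \o f)) => //.
- move=> n; apply/measurable_EFinP; apply: measurable_funM; last exact/measurable_EFinP.
  apply: measurable_funTS.
  by apply: measurableT_comp => //; exact: measurableT_comp.
- move=> x _; apply: cvg_EFin; first exact: nearW.
  rewrite -[X in _ --> X]mul1r; apply: cvgM; last exact: cvg_cst.
  rewrite -[X in _ --> X]expR0; apply: continuous_cvg; first exact: continuous_expR.
  rewrite -[X in _ --> X]oppr0; apply: cvgN.
  rewrite -[X in _ --> X](mul0r x); apply: cvgM => //; exact: cvg_cst.
- move=> n x; rewrite DE => x0; rewrite /= lee_fin normrM (ger0_norm (expR_ge0 _)).
  rewrite ger0_norm ?f0// ler_piMl ?f0//.
  by rewrite -[leRHS]expR0 ler_expR oppr_le0 mulr_ge0 ?p0// ltW.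
Qed.

End limits.

Section main.
Context {R : realType} {d : measure_display} {T : measurableType d}.
Variables (P : probability T R) (S : R -> {RV P >-> R}).
Variables (sigma : {measure set R -> \bar R}) (G : R -> R -> R) (rho : R).
Local Notation mu := (@lebesgue_measure R).
Hypotheses (subS : subordinator S) (sigmaS : levy_measure_of sigma S).
Hypothesis kernel_gt0 : forall t, 0 < t -> 0 < levy_kernel sigma t.
Hypothesis dG : marginal_density S G.
Hypothesis K_cvg0 : l * kernel_laplace sigma l @[l --> 0^'+] --> (0 : R).
Hypothesis rho_ge0 : 0 <= rho.
Hypothesis sv : slowly_varying (fun x => x `^ (- rho) * kernel_laplace sigma x^-1).

Let D : set R := `]0, +oo[%classic.
Let mD : measurable D. Proof. exact: measurable_itv. Qed.
Let DE x : D x = (0 < x) :> Prop.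
Proof. by rewrite /D/= in_itv/= andbT. Qed.

Variable f : R -> R.
Hypothesis fi : mu.-integrable D (EFin \o f).
Hypothesis f0 : forall x, 0 < x -> 0 <= f x.

Let mf : measurable_fun D f.
Proof. by apply/measurable_EFinP; exact: measurable_int fi. Qed.

Let vE := subordinated f G.
Let K := kernel_laplace sigma.
Let Phi := laplace_exponent sigma.
Let Phi_gt0 l : 0 < l -> 0 < Phi l.
Proof. by move=> l0; apply: laplace_exponent_gt0 => //; case: sigmaS. Qed.
Let K_gt0 l : 0 < l -> 0 < K l.
Proof. by move=> l0; apply: kernel_laplace_gt0 => //; case: sigmaS. Qed.
Let PhiE l : 0 < l -> Phi l = l * K l.
Proof. by move=> l0; apply: laplace_exponentE => //; case: sigmaS. Qed.
Let laplace (p : R) := \int[mu]_(x in D) (expR (- (p * x)) * f x).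
(* The Laplace transform of [vE], and [l] times that of its primitive. *)
Let omega (l : R) := K l * laplace (Phi l).

Let mvE : measurable_fun D vE.
Proof. exact: (measurable_subordinated subS dG mf f0). Qed.
Let vE_ge0 t : 0 < t -> (0 <= vE t)%E.
Proof. by move=> t0; exact: (subordinated_ge0 subS dG mf f0). Qed.

Let laplace_fin (p : R) : 0 <= p ->
  (\int[mu]_(x in D) (expR (- (p * x)) * f x)%:E = (laplace p)%:E)%E.
Proof.
move=> p0; rewrite /laplace /Rintegral fineK//; apply: integrable_fin_num => //.
apply: le_integrable fi => //.
- apply/measurable_EFinP; apply: measurable_funM => //.
  apply: measurable_funTS.
  by apply: measurableT_comp => //; exact: measurableT_comp.
- move=> x; rewrite DE => x0; rewrite /= lee_fin normrM (ger0_norm (expR_ge0 _)).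
  rewrite ger0_norm ?f0// ler_piMl ?f0//.
  by rewrite -[leRHS]expR0 ler_expR oppr_le0 mulr_ge0// ltW.
Qed.

Let laplace_vE (l : R) : 0 < l ->
  (\int[mu]_(r in D) ((expR (- (l * r)))%:E * vE r) = (omega l)%:E)%E.
Proof.
move=> l0.
have me (p : R) (B : set R) : measurable_fun B (fun r : R => (expR (- (p * r)))%:E).
  apply/measurable_EFinP/measurable_funTS.
  by apply: measurableT_comp => //; exact: measurableT_comp.
have : (\int[exponential_law l0]_(t in D) vE t =
    \int[mu]_(x in D) ((Phi l * expR (- (Phi l * x)))%:E * (f x)%:E))%E.
  apply: (integral_subordinated subS dG mf f0 l0 (Phi_gt0 l0)) => x x0.
  by case: sigmaS => _ ->//; exact: ltW.
rewrite integral_exponential_law//.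
have -> : (\int[mu]_(t in D) ((l * expR (- (l * t)))%:E * vE t) =
    l%:E * \int[mu]_(r in D) ((expR (- (l * r)))%:E * vE r))%E.
  rewrite -ge0_integralZl//; first by apply: eq_integral => t _; rewrite EFinM muleA.
  - exact: emeasurable_funM (me l D) mvE.
  - by move=> r; rewrite DE => r0; rewrite mule_ge0 ?vE_ge0// lee_fin expR_ge0.
  - by rewrite lee_fin ltW.
have -> : (\int[mu]_(x in D) ((Phi l * expR (- (Phi l * x)))%:E * (f x)%:E) =
    (Phi l)%:E * \int[mu]_(x in D) (expR (- (Phi l * x)) * f x)%:E)%E.
  rewrite -ge0_integralZl//; first by apply: eq_integral => t _; rewrite -!EFinM mulrA.
  - apply/measurable_EFinP; apply: measurable_funM => //.
    by have /measurable_EFinP := me (Phi l) D.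
  - by move=> r; rewrite DE => r0; rewrite lee_fin mulr_ge0 ?f0 ?expR_ge0.
  - by rewrite lee_fin ltW ?Phi_gt0.
rewrite laplace_fin ?(ltW (Phi_gt0 l0))// -EFinM.
have -> : Phi l * laplace (Phi l) = l * omega l by rewrite /omega mulrA -PhiE.
rewrite EFinM => /(congr1 (fun z => l^-1%:E * z)%E).
by rewrite !muleA -!(EFinM l^-1) mulVf ?gt_eqF// !mul1e.
Qed.

Let W t := (\int[mu]_(r in `]0%R, t[) vE r)%E.
Let W_ge0 t : (0 <= W t)%E.
Proof. by apply: integral_ge0 => r /=; rewrite in_itv/= => /andP[r0 _]; exact: vE_ge0. Qed.
Let W_le t : 0 < t -> (W t <= (expR (1 * t) * omega 1)%:E)%E.
Proof.
move=> t0; rewrite EFinM -(laplace_vE ltr01).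
exact: primitive_le.
Qed.
Let W_fin t : 0 < t -> (fine (W t))%:E = W t.
Proof.
move=> t0; rewrite fineK// ge0_fin_numE ?W_ge0//.
by apply: le_lt_trans (W_le t0) _; rewrite ltry.
Qed.

(** If [f] has integral 0, so has [expR (- (p * x)) * f x]: the transform of the
    nonnegative [vE] vanishes, and with it the primitive, by [primitive_le]. *)
Lemma cesaro_mean_subordinated_eq0 : \int[mu]_(x in D) f x = 0 ->
  forall t, 0 < t -> cesaro_mean vE t = 0.
Proof.
move=> f_0 t t0; rewrite /cesaro_mean -/(W t).
have l0 : laplace (Phi 1) = 0.
  apply/eqP; rewrite eq_le; apply/andP; split; last first.
    by apply: Rintegral_ge0 => x; rewrite DE => x0; rewrite mulr_ge0 ?f0 ?expR_ge0.
  rewrite -f_0 -lee_fin -laplace_fin ?(ltW (Phi_gt0 ltr01))//.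
  rewrite /Rintegral fineK; last exact: integrable_fin_num fi.
  apply: ge0_le_integral => //.
  - by move=> x; rewrite DE => x0; rewrite lee_fin mulr_ge0 ?f0 ?expR_ge0.
  - apply/measurable_EFinP; apply: measurable_funM => //.
    apply: measurable_funTS.
    by apply: measurableT_comp => //; exact: measurableT_comp.
  - exact/measurable_EFinP.
  - move=> x; rewrite DE => x0; rewrite lee_fin ler_piMl ?f0//.
    by rewrite -[leRHS]expR0 ler_expR oppr_le0 mulr_ge0// ltW// Phi_gt0.
have : (W t <= 0)%E by apply: le_trans (W_le t0) _; rewrite /omega l0 !mulr0.
rewrite -W_fin// lee_fin => W0.
have -> : fine (W t) = 0 by apply/eqP; rewrite eq_le W0 fine_ge0 ?W_ge0.
by rewrite mulr0.
Qed.

(** As [l] tends to 0, so does [Phi l], hence [omega l] is equivalent to [c * K l]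
    and inherits the regular variation of [K]. Karamata's theorem then applies to
    the primitive of [vE]. *)
Lemma cesaro_mean_subordinated_equiv : \int[mu]_(x in D) f x != 0 ->
  asymp_equiv (fun t => Gamma (rho + 1) * cesaro_mean vE t)
    (fun t => (\int[mu]_(x in D) f x) * (t^-1 * K t^-1)).
Proof.
set c := \int[mu]_(x in D) f x => c_neq0.
have c0 : 0 < c.
  rewrite lt_neqAle eq_sym c_neq0/=.
  by apply: Rintegral_ge0 => x; rewrite DE; exact: f0.
have lap_cvg : laplace (Phi l) @[l --> 0^'+] --> c.
  apply: laplace_cvg0 => //.
    by move=> l l0; rewrite ltW// Phi_gt0.
  apply: cvg_trans K_cvg0; apply: near_eq_cvg; near=> l.
  by rewrite PhiE//; near: l; exact: nbhs_right_gt.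
have lap_gt0 : \forall l \near 0^'+, 0 < laplace (Phi l).
  by apply: cvgr_gt lap_cvg _ _.
have omega_gt0 : \forall l \near 0^'+, 0 < omega l.
  near=> l; rewrite mulr_gt0//.
    by rewrite K_gt0//; near: l; exact: nbhs_right_gt.
  by near: l.
have G0 := gamma_gt0 rho_ge0.
have kar : fine (W l^-1) / omega l @[l --> 0^'+] --> (Gamma (rho + 1))^-1.
  apply: (@karamata_tauberian _ (fun t => fine (W t))) => //.
  - apply: (measurableT_comp (@fine_measurable R setT measurableT)).
    exact: measurable_primitive.
  - by move=> t t0; rewrite fine_ge0 ?W_ge0.
  - move=> t u t0 tu; have u0 := lt_le_trans t0 tu.
    rewrite -lee_fin !W_fin//; apply: ge0_subset_integral => //.
    + by apply: measurable_funS mvE => //; move=> r; rewrite DE/= in_itv/= => /andP[].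
    + by move=> r /=; rewrite in_itv/= => /andP[r0 _]; exact: vE_ge0.
    + by apply: subset_itvl; rewrite bnd_simp.
  - move=> l l0; rewrite -laplace_vE// -(integral_primitive mvE vE_ge0 l0).
    by apply: eq_integral => t; rewrite inE/= in_itv/= andbT => t0; rewrite W_fin.
  - move=> k; have m0 : 0 < k.+1%:R :> R by rewrite ltr0n.
    move: m0; set m := k.+1%:R => m0.
    have lapm := cvg_comp _ _ (cvgMl_at_right m0) lap_cvg.
    have Km := regular_variation_at_right m0 K_gt0 sv.
    have H : K (m * l) / K l * (laplace (Phi (m * l)) / laplace (Phi l))
        @[l --> 0^'+] --> m `^ (- rho).
      rewrite -[X in _ --> X]mulr1 -(divff c_neq0).
      exact: cvgM Km (cvgM lapm (cvgV c_neq0 lap_cvg)).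
    apply: cvg_trans H; apply: near_eq_cvg; near=> l.
    by rewrite mulf_div.
have arith (g w k p u : R) : k != 0 -> p != 0 -> u != 0 ->
    g * (w / (k * p)) * (p * c^-1) = g * (u^-1 * w) / (c * (u^-1 * k)).
  by move=> k0 p0 u0; field; rewrite k0 p0 u0 c_neq0.
rewrite /asymp_equiv.
have H1 : fine (W t^-1^-1) / omega t^-1 @[t --> +oo] --> (Gamma (rho + 1))^-1.
  exact: cvg_comp _ _ cvgV_pinfty_at_right kar.
have H2 : laplace (Phi t^-1) @[t --> +oo] --> c.
  exact: cvg_comp _ _ cvgV_pinfty_at_right lap_cvg.
have H2_gt0 : \forall t \near +oo, 0 < laplace (Phi t^-1).
  by apply: cvgr_gt H2 _ _.
have H : Gamma (rho + 1) * (fine (W t^-1^-1) / omega t^-1) * (laplace (Phi t^-1) * c^-1)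
    @[t --> +oo] --> Gamma (rho + 1) * (Gamma (rho + 1))^-1 * (c * c^-1).
  by apply: cvgM; [apply: cvgM => //; exact: cvg_cst|apply: cvgM => //; exact: cvg_cst].
have one : Gamma (rho + 1) * (Gamma (rho + 1))^-1 * (c * c^-1) = 1.
  by rewrite !divff ?mulr1// gt_eqF.
move: H; rewrite one => H; apply: cvg_trans H; apply: near_eq_cvg; near=> t.
have t0 : 0 < t by near: t; exact: nbhs_pinfty_gt.
have lapl : laplace (Phi t^-1) != 0.
  by rewrite gt_eqF//; near: t.
have Kl : K t^-1 != 0 by rewrite gt_eqF ?K_gt0 ?invr_gt0.
have t_neq0 : t != 0 by rewrite gt_eqF.
rewrite invrK; exact: arith.
Unshelve. all: by end_near. Qed.

End main.

Theorem theorem1p1 (R : realType) (N : nat) (a b gamma alpha s : R)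
    (V : ('rV[R]_N -> R) -> 'rV[R]_N -> R -> R)
    (d : measure_display) (T : measurableType d) (P : probability T R)
    (S : R -> {RV P >-> R}) (sigma : {measure set R -> \bar R})
    (G : R -> R -> R) (rho : R) :
  (1 <= N)%N -> 0 <= a -> 0 <= b -> 0 <= gamma ->
  0 < alpha -> alpha <= 1 -> 0 < s -> s < 1 ->
  (forall phi : 'rV[R]_N -> R, (forall x, 0 <= phi x) ->
     phi \in Lfun (lebesgue_rV R N) 1 ->
     phi \in Lfun (lebesgue_rV R N) +oo%E ->
     [/\ is_solution a b gamma alpha s phi (V phi),
         forall x t, 0 <= t -> 0 <= V phi x t &
         forall x, (@lebesgue_measure R).-integrable `]0, +oo[
                     (EFin \o V phi x)]) ->
  subordinator S ->
  levy_measure_of sigma S ->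
  (forall t, 0 < t -> 0 < levy_kernel sigma t) ->
  locally_integrable `]0, +oo[ (levy_kernel sigma) ->
  marginal_density S G ->
  lambda * kernel_laplace sigma lambda @[lambda --> 0^'+] --> (0 : R) ->
  0 <= rho ->
  slowly_varying (fun x => x `^ (- rho) * kernel_laplace sigma x^-1) ->
  forall phi : 'rV[R]_N -> R, (forall x, 0 <= phi x) ->
    phi \in Lfun (lebesgue_rV R N) 1 ->
    phi \in Lfun (lebesgue_rV R N) +oo%E ->
    forall x : 'rV[R]_N,
      let v := V phi in
      let vE := subordinated (v x) G in
      (L1norm (v x) != 0 ->
       asymp_equiv
         (fun t => Gamma (rho + 1) * cesaro_mean vE t)
         (fun t => L1norm (v x) * (t^-1 * kernel_laplace sigma t^-1))) /\
      (L1norm (v x) = 0 -> forall t, 0 < t -> cesaro_mean vE t = 0).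
Proof.
move=> _ _ _ _ _ _ _ _ HV subS sigmaS k0 _ dG K0 rho0 sv phi phi0 phi1 phioo x v vE.
have [_ v0 vi] := HV phi phi0 phi1 phioo.
have f0 (t : R) : 0 < t -> 0 <= v x t by move=> /ltW; exact: v0.
have normE : L1norm (v x) = \int[lebesgue_measure]_(t in `]0, +oo[) v x t.
  apply: eq_Rintegral => t; rewrite inE/= in_itv/= andbT => t0.
  by rewrite ger0_norm// f0.
rewrite normE; split.
- exact: (cesaro_mean_subordinated_equiv subS sigmaS k0 dG K0 rho0 sv (vi x) f0).
- exact: (cesaro_mean_subordinated_eq0 subS sigmaS k0 dG (vi x) f0).
Qed.
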